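(* (Alexander–Hirschowitz's theorem in dimension $3$, degrees $d\ge 5$.) For every integer $d\geq 5$ and every integer $k\geq 0$, the Veronese threefold $V_{3,d}\subset\mathbb{P}^{N_d}$, where $N_d=\binom{d+3}{3}-1$, is not $k$-defective; that is, $\dim \mathrm{Sec}_k(V_{3,d})=\min\{4(k+1)-1,\,N_d\}$.
   Context: Varieties are over the complex numbers. $V_{3,d}$ is the image of $\mathbb{P}^3$ under the Veronese embedding $\mathbb{P}^3\to\mathbb{P}^{N_d}$ given by the complete linear system $|\mathcal{O}_{\mathbb{P}^3}(d)|$. For an irreducible non-degenerate projective variety $X\subset\mathbb{P}^N$ of dimension $n$ and an integer $k\ge 0$, $\mathrm{Sec}_k(X)$ is the Zariski closure of the union of all $k$-dimensional linear spans $\langle p_0,\dots,p_k\rangle$ of $k+1$ linearly independent points of $X$ (so $\mathrm{Sec}_0(X)=X$); for $k>N$, where no such points exist, set $\mathrm{Sec}_k(X)=\mathbb{P}^N$. One always has $\dim \mathrm{Sec}_k(X)\le\min\{(n+1)(k+1)-1,N\}$; $X$ is called $k$-defective if this inequality is strict, and not $k$-defective if equality holds. *)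

(* Defs.v *)
From HB Require Import structures.
From mathcomp Require Import all_boot all_order all_algebra.
From mathcomp Require Import mpoly complex.
From mathcomp Require Import boolp classical_sets reals.

Set Implicit Arguments.
Unset Strict Implicit.
Unset Printing Implicit Defensive.

Import GRing.Theory.
Local Open Scope ring_scope.
Local Open Scope classical_set_scope.

(* The points of P^n are the lines through the origin of K^(n+1). *)
Definition pspace (K : fieldType) (n : nat) :=
  {L : {vspace 'rV[K]_n.+1} | \dim L == 1%N}.

(* Homogeneous polynomials of any degrees are allowed, constants included.
   Since f is homogeneous, its vanishing on the whole line p amounts to its
   vanishing at any one nonzero vector of p. *)
Definition zero_locus (K : fieldType) (n : nat) (F : set {mpoly K[n.+1]}) :
    set (pspace K n) :=
  [set p : pspace K n | forall f, F f -> forall v : 'rV[K]_n.+1,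
     v \in val p -> f.@[fun j => v 0 j] = 0].

Definition zariski_closed (K : fieldType) (n : nat) (Z : set (pspace K n)) :=
  exists2 F : set {mpoly K[n.+1]},
    (forall f, F f -> exists e : nat, f \is e.-homog) & Z = zero_locus F.

Definition zariski_closure (K : fieldType) (n : nat) (X : set (pspace K n)) :
    set (pspace K n) :=
  smallest (@zariski_closed K n) X.

Lemma zariski_closure_closed (K : fieldType) (n : nat)
  (X : set (pspace K n)) : zariski_closed (zariski_closure X).
Proof.
pose F : set {mpoly K[n.+1]} := [set f | (exists e : nat, f \is e.-homog) /\
  forall p, X p -> forall v : 'rV[K]_n.+1, v \in val p ->
    f.@[fun j => v 0 j] = 0].
exists F => [f []//|]; apply/seteqP; split=> p.
- apply; split; last by move=> q Xq f [_ fX]; apply: fX.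
  by exists F => // f [].
- move=> pF _ [[G Ghom ->] XG] f Gf; apply: pF; split; first exact: Ghom.
  by move=> q /XG; apply.
Qed.

Definition zariski_irreducible (K : fieldType) (n : nat)
    (Z : set (pspace K n)) :=
  Z !=set0 /\
  forall A B : set (pspace K n), zariski_closed A -> zariski_closed B ->
    Z `<=` A `|` B -> Z `<=` A \/ Z `<=` B.

Definition closed_chain (K : fieldType) (n : nat) (X : set (pspace K n))
    (r : nat) (Z : nat -> set (pspace K n)) :=
  (forall i, (i <= r)%N ->
     [/\ zariski_closed (Z i), zariski_irreducible (Z i) & Z i `<=` X]) /\
  (forall i, (i < r)%N -> Z i `<` Z i.+1).

(* r is the supremum of the lengths of the chains Z_0 < ... < Z_r of
   irreducible closed subsets of X. *)
Definition is_krull_dim (K : fieldType) (n : nat) (X : set (pspace K n))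
    (r : nat) :=
  (exists Z, closed_chain X r Z) /\
  (forall s Z, closed_chain X s Z -> (s <= r)%N).

(* Intended for nonempty closed X; the default value 0 is taken only if no
   natural number satisfies is_krull_dim, e.g. for the empty set. *)
Definition krull_dim (K : fieldType) (n : nat) (X : set (pspace K n)) : nat :=
  xget 0%N (is_krull_dim X).

(* p_0, ..., p_k are linearly independent when the lines they stand for span
   a subspace of dimension k + 1, and q lies on <p_0, ..., p_k> when the line q
   is contained in that subspace. *)
Definition Sec (K : fieldType) (N k : nat) (X : set (pspace K N)) :
    set (pspace K N) :=
  if (k <= N)%N then
    zariski_closure [set q | exists p : 'I_k.+1 -> pspace K N,
      [/\ forall i, X (p i),
          \dim (\sum_i val (p i))%VS = k.+1 &
          (val q <= \sum_i val (p i))%VS]]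
  else setT.

Definition expected_dim (n N k : nat) : nat :=
  minn ((n + 1) * (k + 1) - 1) N.

Definition k_defective (K : fieldType) (N k : nat) (X : set (pspace K N)) :=
  (krull_dim (Sec k X) < expected_dim (krull_dim X) N k)%N.

(* The monomials of degree d in n variables, each listed once (basis_cover,
   uniq_basis in mpoly); their order only permutes the coordinates of the
   target of the Veronese embedding. *)
Definition monomials (n d : nat) : seq 'X_{1..n} :=
  [seq s2m (val t) | t <- enum (basis n d)].

Lemma size_monomials (n d : nat) :
  size (monomials n.+1 d) = ('C(d + n, n).-1).+1.
Proof.
rewrite size_basis prednK ?bin_gt0 ?leq_addl //.
by rewrite -(bin_sub (leq_addl d n)) addnK.
Qed.

Definition veronese_vec (K : fieldType) (n d : nat) (v : 'rV[K]_n.+1) :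
    'rV[K]_('C(d + n, n).-1).+1 :=
  \row_i \prod_(j < n.+1) v 0 j ^+ (nth 0%MM (monomials n.+1 d) i) j.

(* V_{n,d}, the image of [v] |-> [veronese_vec d v] for v <> 0. *)
Definition Veronese (K : fieldType) (n d : nat) :
    set (pspace K 'C(d + n, n).-1) :=
  [set q | exists2 v : 'rV[K]_n.+1,
     v != 0 & val q = <[veronese_vec d v]>%VS].
Arguments Veronese : clear implicits.

(* Main.v *)
Require Import Defs.
From mathcomp Require Import all_boot all_order all_algebra.
From mathcomp Require Import complex.
From mathcomp Require Import boolp classical_sets reals.
From mathcomp Require Import mpoly zify ring.

(* The cone over Sec_k(V_{3,d}) is the closure of the image of the polynomial map
   (v_0, ..., v_k) |-> sum_i veronese_vec v_i, a map between affine spaces.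

   Dimension.  A chain Z_0 < ... < Z_s of irreducible closed sets provides s + 1 polynomials
   that are algebraically independent on Z_s; since n + 1 polynomials in n variables are
   dependent, the image of K^n contains only chains of length s < n.  Conversely, if the
   Jacobian matrix at p has rank r + 1, the closures of the images of a suitable flag of
   linear subspaces through p form a chain of length r, because the Jacobian criterion makes
   the numbers of independent functions on consecutive members different.

   Rank of the Jacobian matrix.  Its rows are the conditions for a form of degree d to be
   singular at k + 1 points.  If the set of monomials is cut by a plane into two parts, and
   the points of one part are moved by a one-parameter subgroup of the torus, the matrix
   degenerates to a block triangular one, so the ranks obtained for the two parts add up
   (this is the tropical method of Draisma).  A single point imposes four conditions on four
   monomials with affinely independent exponents.  It remains to cut the lattice points of
   the tetrahedron of size d by successive planes into affinely independent quadruples, with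
   at most one smaller piece.  For odd d, peel off the layers x_3 <= 1, cut them into beams
   x_2 <= 1, and those into a unit simplex and sheared unit cubes.  For even d, take away the
   three layers x_3 <= 2, which leaves an odd tetrahedron; cut them into pieces of width 8 in
   the direction of x_2, and treat the finitely many remaining shapes explicitly. *)

Set Implicit Arguments.
Unset Strict Implicit.
Unset Printing Implicit Defensive.

Import Order.TTheory GRing.Theory Num.Theory.
Local Open Scope ring_scope.

(** * Polynomials in several variables *)

(** In characteristic zero [1, ..., size q] are distinct nonzero elements, too many to be roots of a
    nonzero [q]. *)
Lemma poly_vanish (K : numFieldType) (q : {poly K}) :
  (forall t, t != 0 -> q.[t] = 0) -> q = 0.
Proof.
move=> q0; apply/eqP/negPn/negP => nzq.
have := @max_poly_roots _ q [seq i.+1%:R | i <- iota 0 (size q)] nzq.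
rewrite size_map size_iota ltnn => H; suff: false by [].
apply: H.
  by apply/allP => _ /mapP[i _ ->]; apply/eqP/q0; rewrite pnatr_eq0.
rewrite map_inj_uniq ?iota_uniq // => i j /eqP.
by rewrite eqr_nat eqSS => /eqP.
Qed.

Lemma meval_line (K : comNzRingType) n (p : {mpoly K[n]}) (h : 'I_n -> {poly K}) :
  exists q : {poly K}, forall t, q.[t] = p.@[fun i => (h i).[t]].
Proof.
elim/mpolyind: p => [|c m p _ _ [q qE]]; first by exists 0 => t; rewrite meval0 horner0.
exists (c *: \prod_i h i ^+ m i + q) => t.
rewrite hornerD hornerZ qE mevalD mevalZ mevalX horner_prod.
by congr (_ * _ + _); apply: eq_bigr => i _; rewrite horner_exp.
Qed.

(** Division by the last variable: the monomials free of it make up the remainder. Inductions on the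
    degree below pass from [G] to [H]. *)
Lemma mpoly_split_max (K : comNzRingType) n (G : {mpoly K[n.+1]}) :
  exists H G0, G = 'X_ord_max * H + mwiden G0.
Proof.
elim/mpolyind: G => [|c m p _ _ [H [G0 ->]]].
  by exists 0, 0; rewrite mulr0 mwiden0 addr0.
have [m0|m0] := posnP (m ord_max).
  exists H, (c *: 'X_[ [multinom m (widen_ord (leqnSn n) i) | i < n] ] + G0).
  rewrite mwidenD mwidenZ mwidenX addrCA; congr (_ + (_ *: 'X_[_] + _)).
  apply/mnmP => i; have [->|ni] := eqVneq i ord_max.
    by rewrite mnmwiden_ordmax.
  have li : (i < n)%N by rewrite ltn_neqAle -ltnS ltn_ord andbT;
    apply: contra ni => /eqP ?; apply/eqP/val_inj.
  rewrite (_ : i = widen_ord (leqnSn n) (Ordinal li)); last exact/val_inj.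
  by rewrite mnmwiden_widen mnmE.
exists (c *: 'X_[m - U_(ord_max)] + H), G0.
rewrite mulrDr -addrA -scalerAr -mpolyXD addmC submK //.
by rewrite lep1mP -lt0n.
Qed.

Lemma meval_mwiden (K : comNzRingType) n (p : {mpoly K[n]}) v :
  (mwiden p).@[v] = p.@[fun i => v (widen_ord (leqnSn n) i)].
Proof.
elim/mpolyind: p => [|c m p _ _ IH]; first by rewrite mwiden0 !meval0.
rewrite mwidenD mwidenZ mwidenX !mevalD !mevalZ IH !mevalX; congr (_ * _ + _).
rewrite big_ord_recr /= mnmwiden_ordmax expr0 mulr1.
by apply: eq_bigr => i _; rewrite mnmwiden_widen.
Qed.

Lemma msize_mulX (K : idomainType) n (p : {mpoly K[n]}) i :
  p != 0 -> msize ('X_i * p) = (msize p).+1.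
Proof.
move=> p0; rewrite msizeM ?msizeX ?mdeg1 //.
by apply/eqP => /(congr1 (mcoeff U_(i))); rewrite mcoeffX eqxx mcoeff0 => /eqP; rewrite oner_eq0.
Qed.

(** The remainder [G0] is the restriction to the hyperplane where the last variable is 0, so it is
    zero by induction on [n]. The quotient [H] then vanishes off this hyperplane, hence everywhere
    by restriction to lines, and it has smaller degree. *)
Lemma mpoly_vanish (K : numFieldType) n (p : {mpoly K[n]}) :
  (forall v, p.@[v] = 0) -> p = 0.
Proof.
elim: n p => [|n IHn] p p0.
  move: (p0 (fun=> 0)); elim/mpolyind: p p0 => // c m p mp c0 _ _.
  move=> /eqP; rewrite (_ : m = 0%MM) in mp *; last by apply/mnmP => -[].
  have -> : p = 0.
    apply/mpolyP => m'; rewrite mcoeff0 (_ : m' = 0%MM); last by apply/mnmP => -[].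
    exact: memN_msupp_eq0.
  by rewrite addr0 mevalZ mevalX big_ord0 mulr1 (negPf c0).
have [k] := ubnP (msize p); elim: k p p0 => // k IHk p p0 szp.
have [->//|nzp] := eqVneq p 0.
have [H [G0 pE]] := mpoly_split_max p.
have G00 : G0 = 0.
  apply: IHn => v.
  have := p0 (fun i => if unlift ord_max i is Some j then v j else 0).
  rewrite pE mevalD mevalM mevalXU unlift_none mul0r add0r meval_mwiden => E.
  rewrite -[RHS]E; apply: meval_eq => i.
  by rewrite (_ : widen_ord _ i = lift ord_max i) ?liftK //;
    apply/val_inj; rewrite /= /bump leqNgt ltn_ord.
rewrite G00 mwiden0 addr0 in pE.
have nzH : H != 0 by apply: contraNneq nzp => H0; rewrite pE H0 mulr0.
suff /IHk : forall v, H.@[v] = 0.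
  by move=> H0; rewrite pE H0 ?mulr0 // -ltnS (leq_trans _ szp) // pE msize_mulX.
move=> v; pose h i : {poly K} := if i == ord_max then 'X else (v i)%:P.
have [q qE] := meval_line H h.
suff q0 : q = 0.
  transitivity q.[v ord_max]; last by rewrite q0 horner0.
  rewrite qE; apply: meval_eq => i; rewrite /h.
  by case: eqP => [->|]; rewrite ?hornerX ?hornerC.
apply: poly_vanish => t t0; rewrite qE.
have := p0 (fun i => (h i).[t]); rewrite pE mevalM mevalXU /h eqxx hornerX.
by move/eqP; rewrite mulf_eq0 (negPf t0) => /eqP.
Qed.

Lemma meval_homog (K : comNzRingType) n e (f : {mpoly K[n]}) (t : K) (v : 'I_n -> K) :
  f \is e.-homog -> f.@[fun i => t * v i] = t ^+ e * f.@[v].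
Proof.
move=> /dhomogP fe; rewrite !mevalE mulr_sumr big_seq [RHS]big_seq.
apply: eq_bigr => m /fe <-; rewrite mulrCA; congr (_ * _).
under eq_bigr do rewrite exprMn.
by rewrite big_split /= mdegE prodrXr.
Qed.

(** On the line through [v], [f] becomes a polynomial in [t] whose coefficients are the values at
    [v] of its homogeneous components. *)
Lemma pihomog_vanish (K : numFieldType) n (f : {mpoly K[n]}) (v : 'I_n -> K) :
  (forall t, f.@[fun i => t * v i] = 0) ->
  forall e, (pihomog mdeg e f).@[v] = 0.
Proof.
move=> f0 e; pose k := maxn (msize f) e.+1.
pose q := \poly_(d < k) (pihomog mdeg d f).@[v].
suff q0 : q = 0.
  have := coef_poly k (fun d => (pihomog mdeg d f).@[v]) e.
  by rewrite leq_max ltnSn orbT -/q q0 coef0.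
apply: poly_vanish => t _; rewrite horner_poly -[RHS](f0 t).
have /= -> := pihomog_partitionE (leq_maxl (msize f) e.+1).
rewrite raddf_sum /=; apply: eq_bigr => d _.
by rewrite (meval_homog _ _ (pihomogP _ _ _)) mulrC -pihomog_partitionE ?leq_maxl.
Qed.

(** The chain rule. It is linear in [G] and, by the Leibniz rule, stable under products, so only
    single variables have to be checked. *)
Lemma mderiv_comp (K : comNzRingType) n m (psi : n.-tuple {mpoly K[m]})
    (G : {mpoly K[n]}) i :
  (G \mPo psi)^`M(i) = \sum_j (G^`M(j) \mPo psi) * (tnth psi j)^`M(i).
Proof.
pose P (G : {mpoly K[n]}) :=
  (G \mPo psi)^`M(i) = \sum_j (G^`M(j) \mPo psi) * (tnth psi j)^`M(i).
rewrite -/(P G).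
have PM F H : P F -> P H -> P (F * H).
  rewrite /P => PF PH; rewrite rmorphM /= mderivM PF PH mulr_suml mulr_sumr -big_split /=.
  apply: eq_bigr => j _; rewrite mderivM rmorphD !rmorphM /= mulrDl.
  by congr (_ + _); rewrite ?mulrA // -!mulrA [_^`M(i) * _]mulrC.
have P1 : P 1.
  rewrite /P rmorph1 -mpolyC1 mderivC big1 // => j _.
  by rewrite -mpolyC1 mderivC comp_mpoly0 mul0r.
elim/mpolyind: G => [|c mm p _ _ Pp].
  by rewrite /P comp_mpoly0 mderiv0 big1 // => j _; rewrite mderiv0 comp_mpoly0 mul0r.
rewrite /P comp_mpolyD mderivD Pp comp_mpolyZ mderivZ.
have -> : ('X_[mm] \mPo psi)^`M(i) = \sum_j ('X_[mm]^`M(j) \mPo psi) * (tnth psi j)^`M(i).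
  rewrite -/(P 'X_[mm]) mpolyXE_id; apply: big_ind => // j _.
  elim: (mm j) => [|a IH]; first by rewrite expr0.
  rewrite exprS; apply: PM => //.
  rewrite /P comp_mpolyXU -tnth_nth (bigD1 j) //= big1 ?addr0 => [|l lj].
    by rewrite mderivX mnm1E eqxx scale1r -{1}[U_(j)%MM]add0m addmK mpolyX0 rmorph1 mul1r.
  by rewrite mderivX mnm1E eq_sym (negPf lj) scale0r comp_mpoly0 mul0r.
rewrite scaler_sumr -big_split /=; apply: eq_bigr => j _.
by rewrite mderivD mderivZ comp_mpolyD comp_mpolyZ mulrDl scalerAl.
Qed.

Lemma mpoly_const (K : numDomainType) n (G : {mpoly K[n]}) :
  (forall j, G^`M(j) = 0) -> G = (G@_0)%:MP.
Proof.
move=> G0; apply/mpolyP => m; rewrite mcoeffC.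
have [->|m0] := eqVneq; first by rewrite mulr1.
have [j mj] : exists j, m j != 0%N.
  apply/existsP; apply: contraNT m0; rewrite negb_exists => /forallP m0.
  by apply/eqP/mnmP => j; rewrite mnm0E; apply/eqP/negPn/m0.
have := mcoeff_deriv j (m - U_(j)) G; rewrite G0 mcoeff0 submK ?lep1mP //.
by move/esym/eqP; rewrite mulrn_eq0 /= => /eqP ->; rewrite mulr0.
Qed.

(* A relation of minimal degree, differentiated by the chain rule, gives relations of
   smaller degree after multiplication by the adjugate of the Jacobian matrix. *)
Lemma jacobian_criterion (K : numFieldType) n (psi : n.-tuple {mpoly K[n]})
    (p : 'I_n -> K) :
  \det (\matrix_(i, j) ((tnth psi j)^`M(i)).@[p]) != 0 ->
  forall G : {mpoly K[n]}, G \mPo psi = 0 -> G = 0.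
Proof.
move=> nzdet G; pose J := \matrix_(i, j) (tnth psi j)^`M(i).
have nzJ : \det J != 0.
  apply: contraNneq nzdet => J0; rewrite -(meval0 p) -J0 -det_map_mx.
  by apply/eqP; congr (\det _); apply/matrixP => i j; rewrite !mxE.
have [k] := ubnP (msize G); elim: k G => // k IHk G szG G0.
have [->//|nzG] := eqVneq G 0.
suff G'0 j : G^`M(j) = 0.
  move: G0; rewrite (mpoly_const G'0) comp_mpolyC => /eqP.
  by rewrite mpolyC_eq0 => /eqP ->.
apply: IHk.
  rewrite ltnS in szG; apply: leq_trans szG.
  have [G'0|nz] := eqVneq G^`M(j) 0.
    rewrite G'0 msize0 lt0n msize_poly_eq0; apply: contraTneq nzG => ->.
    by rewrite eqxx.
  have := mlead_supp nz; rewrite -mlead_deg // mcoeff_msupp mcoeff_deriv.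
  set m := mlead _ => mG; suff : (m + U_(j))%MM \in msupp G.
    by move=> /msize_mdeg_lt; rewrite mdegD mdeg1 addn1.
  by rewrite mcoeff_msupp; apply: contraNneq mG => ->; rewrite mul0rn.
pose d : 'cV[{mpoly K[n]}]_n := \col_j (G^`M(j) \mPo psi).
have Jd : J *m d = 0.
  apply/matrixP => i l; rewrite !mxE.
  under eq_bigr do rewrite !mxE mulrC.
  by rewrite -mderiv_comp G0 mderiv0.
have : \det J *: d = 0.
  by rewrite -mul_scalar_mx -mul_adj_mx -mulmxA Jd mulmx0.
move=> /matrixP /(_ j 0); rewrite !mxE => /eqP.
by rewrite mulf_eq0 (negPf nzJ) => /eqP.
Qed.

Lemma msize_prod_exp_le (K : idomainType) n k (psi : 'I_k -> {mpoly K[n]}) (b : 'I_k -> nat)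
    (D e : nat) :
  (forall j, msize (psi j) <= D.+1)%N -> (forall j, b j <= e)%N ->
  (msize (\prod_j psi j ^+ b j) <= (k * D * e).+1)%N.
Proof.
move=> psiD be.
have mulP (p q : {mpoly K[n]}) x y : (msize p <= x.+1)%N -> (msize q <= y.+1)%N ->
    (msize (p * q) <= (x + y).+1)%N.
  have [->|p0] := eqVneq p 0; first by rewrite mul0r msize0.
  have [->|q0] := eqVneq q 0; first by rewrite mulr0 msize0.
  by rewrite msizeM //; lia.
have expP j a : (msize (psi j ^+ a) <= (a * D).+1)%N.
  elim: a => [|a IH]; first by rewrite expr0 msize1.
  by rewrite exprS mulSn; apply: mulP.
have : (msize (\prod_j psi j ^+ b j) <= (\sum_(j < k) e * D).+1)%N.
  elim/big_rec2: _ => [|j x y _ IH]; first by rewrite msize1.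
  apply: mulP => //; apply: leq_trans (expP _ _) _.
  by rewrite ltnS leq_mul2r be orbT.
by rewrite sum_nat_const card_ord mulnA mulnAC.
Qed.

(* Counting: the (e+1)^k monomials of degree at most e in each psi_j lie in a space of
   dimension (B+1)^n, where B is linear in e. *)
Lemma mpoly_dependent (K : fieldType) n k (psi : k.-tuple {mpoly K[n]}) :
  (n < k)%N -> exists2 G : {mpoly K[k]}, G != 0 & G \mPo psi = 0.
Proof.
move=> nk; pose D := (\sum_j msize (tnth psi j))%N.
(* With this [e] one has (B+1)^n <= ((kD+1)(e+1))^n = e (e+1)^n < (e+1)^(n+1) <= (e+1)^k. *)
pose e := ((k * D).+1 ^ n)%N; pose B := (k * D * e)%N.
pose R := {ffun 'I_k -> 'I_e.+1}; pose C := {ffun 'I_n -> 'I_B.+1}.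
pose mon (f : R) : 'X_{1..k} := [multinom (f i : nat) | i < k].
pose mon' (f : C) : 'X_{1..n} := [multinom (f i : nat) | i < n].
pose M : 'M[K]_(#|R|, #|C|) :=
  \matrix_(a, b) ('X_[mon (enum_val a)] \mPo psi)@_(mon' (enum_val b)).
have RC : (#|C| < #|R|)%N.
  rewrite !card_ffun !card_ord; apply: (@leq_trans (e.+1 ^ n.+1));
    last by rewrite leq_exp2l // ltnS expn_gt0.
  apply: (@leq_ltn_trans (((k * D).+1 * e.+1) ^ n)).
    have [->|n0] := posnP n; first by rewrite !expn0.
    by rewrite leq_exp2r // /B; nia.
  by rewrite expnMn expnS ltn_pmul2r ?expn_gt0 // -/e.
have kerM : kermx M != 0.
  rewrite -mxrank_eq0 mxrank_ker -lt0n subn_gt0.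
  exact: leq_ltn_trans (rank_leq_col M) RC.
pose u := nz_row (kermx M).
have u0 : u != 0 by rewrite nz_row_eq0.
have uM : u *m M = 0 by apply/sub_kermxP/nz_row_sub.
exists (\sum_a u 0 a *: 'X_[mon (enum_val a)]).
  have [a ua] : exists a, u 0 a != 0.
    apply/existsP; apply: contraNT u0; rewrite negb_exists => /forallP ua.
    by apply/eqP/rowP => a; rewrite mxE; apply/eqP/negPn/ua.
  apply: contraNneq ua => /(congr1 (mcoeff (mon (enum_val a)))).
  rewrite mcoeff0 raddf_sum /= (bigD1 a) //= mcoeffZ mcoeffX eqxx mulr1.
  rewrite big1 ?addr0 => [->//|b ba]; rewrite mcoeffZ mcoeffX.
  case: eqP => [E|]; rewrite ?mulr0 //; case/eqP: ba; apply: enum_val_inj.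
  apply/ffunP => i; apply/val_inj; move/mnmP: E => /(_ i).
  by rewrite !mnmE.
rewrite raddf_sum /=; apply/mpolyP => m; rewrite mcoeff0 raddf_sum /=.
(* Coefficients with an exponent above [B] vanish for degree reasons; the others are entries of
   [u *m M]. *)
have [mB|mB] := boolP [forall i, m i < B.+1]%N; last first.
  apply: big1 => a _; rewrite comp_mpolyZ mcoeffZ.
  rewrite (memN_msupp_eq0 (msize_mdeg_ge _)) ?mulr0 //.
  move: mB; rewrite negb_forall; case/existsP=> i; rewrite -leqNgt => Bi.
  apply: leq_trans (leq_trans Bi _); last by rewrite mdegE (bigD1 i) //= leq_addr.
  rewrite comp_mpolyX; under eq_bigr do rewrite mnmE.
  apply: msize_prod_exp_le => j; last by rewrite -ltnS.
  by rewrite leqW // /D (bigD1 j) //= leq_addr.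
move/forallP: mB => mB; pose g : C := [ffun i => Ordinal (mB i)].
have -> : m = mon' g by apply/mnmP => i; rewrite mnmE ffunE.
move/rowP: uM => /(_ (enum_rank g)); rewrite !mxE => uM.
rewrite -[RHS]uM; apply: eq_bigr => a _.
by rewrite comp_mpolyZ mcoeffZ mxE enum_rankK.
Qed.

(** * Degeneration of interpolation conditions *)

(** The two factors turn a rank bound into a matrix identity, which can be deformed and tested by a
    determinant. *)
Lemma mxrank_ge_id (F : fieldType) m n (A : 'M[F]_(m, n)) r : (r <= \rank A)%N ->
  exists P : 'M_(r, m), exists Q : 'M_(n, r), P *m A *m Q = 1%:M.
Proof.
move=> rA; have /row_freeP[Q BQ] := row_base_free A.
have /row_fullP[P PB] := col_base_full A.
exists (pid_mx r *m P), (Q *m pid_mx r).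
have PAQ : P *m A *m Q = 1%:M.
  by rewrite -[X in P *m X *m Q]mulmx_base mulmxA PB mul1mx BQ.
rewrite !mulmxA -(mulmxA _ P) -(mulmxA _ _ Q) PAQ mulmx1.
by rewrite mul_pid_mx minnn (minn_idPr rA) pid_mx_1.
Qed.

Definition col_mask (K : pzRingType) n (A : pred 'I_n) : 'M[K]_n := diag_mx (\row_i (A i)%:R).

Lemma mul_mask (K : pzRingType) n (A B : pred 'I_n) :
  col_mask K A *m col_mask K B = col_mask K [pred i | A i && B i].
Proof.
rewrite /col_mask mulmx_diag; congr (diag_mx _); apply/rowP => i; rewrite !mxE /=.
by rewrite -natrM mulnb.
Qed.

Lemma mask_diagC (K : comPzRingType) n (A : pred 'I_n) (d : 'rV[K]_n) :
  col_mask K A *m diag_mx d = diag_mx d *m col_mask K A.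
Proof. by rewrite /col_mask !mulmx_diag; congr (diag_mx _); apply/rowP => i; rewrite !mxE mulrC. Qed.

(* After rescaling rows and columns by powers of t, the matrix becomes block triangular at
   t = 0; its determinant is then nonzero for some t <> 0. *)
Lemma torus_degeneration (K : numFieldType) n p q (A B : pred 'I_n) (U : 'M[K]_(p, n))
    (W : 'M[K]_(q, n)) (w : 'I_n -> nat) (c : nat) :
  (forall i, A i -> (c <= w i)%N) -> (forall i, B i -> (w i < c)%N) ->
  exists2 t : K, t != 0 &
    (\rank (U *m col_mask K A) + \rank (W *m col_mask K B) <=
     \rank (col_mx U (W *m diag_mx (\row_i t ^+ w i))))%N.
Proof.
move=> wA wB.
have [P1 [Q1 PQ1]] := mxrank_ge_id (leqnn (\rank (U *m col_mask K A))).
have [P2 [Q2 PQ2]] := mxrank_ge_id (leqnn (\rank (W *m col_mask K B))).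
set ra := \rank _ in P1 Q1 PQ1 *; set rb := \rank _ in P2 Q2 PQ2 *.
(* Subtraction is truncated: the exponent in [S] is positive on [B], and on [A] the exponent in [T]
   is the true difference. *)
pose S (R : comNzRingType) (t : R) : 'M[R]_n := diag_mx (\row_i t ^+ (c - w i)).
pose T (R : comNzRingType) (t : R) : 'M[R]_n := diag_mx (\row_i t ^+ (w i - c)).
set X1 := P1 *m U; set X2 := P2 *m W; set Y1 := col_mask K A *m Q1; set Y2 := col_mask K B *m Q2.
(* The family is written over any ring receiving [K]: at ['X] its determinant is a polynomial, which
   specializes to each value of [t]. *)
pose Nt (R : comNzRingType) (h : K -> R) (t : R) : 'M[R]_(ra + rb) :=
  block_mx 1%:M (map_mx h X1 *m S R t *m map_mx h Y2)
           (map_mx h X2 *m T R t *m map_mx h Y1) 1%:M.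
have NtE (t : K) : map_mx (horner_eval t) (Nt _ polyC 'X) = Nt K id t.
  have hC a b (M : 'M[K]_(a, b)) : map_mx (horner_eval t) (map_mx polyC M) = map_mx id M.
    by apply/matrixP => i j; rewrite !mxE /horner_eval hornerC.
  have hS (f : 'I_n -> nat) : map_mx (horner_eval t) (diag_mx (\row_i 'X ^+ f i)) =
      diag_mx (\row_i t ^+ f i).
    by apply/matrixP => i j; rewrite !mxE /horner_eval hornerMn hornerXn.
  rewrite /Nt /S /T map_block_mx !map_mxM !map_mx1 !hC !hS !map_mx_id //.
(* At [t = 0] the upper right block vanishes, its exponents [c - w i] being positive on [B]. *)
have det0 : \det (Nt K id 0) = 1.
  rewrite /Nt (_ : _ *m S K 0 *m _ = 0) ?det_lblock ?det1 ?mulr1 //.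
  rewrite !map_mx_id // -mulmxA /Y2 (mulmxA (S K 0)) (_ : S K 0 *m _ = 0) ?mul0mx ?mulmx0 //.
  rewrite mulmx_diag; apply/matrixP => i j; rewrite !mxE.
  case: (boolP (B i)) => [/wB|]; last by rewrite mulr0 mul0rn.
  by rewrite -subn_gt0 => wi; rewrite expr0n eqn0Ngt wi mul0r mul0rn.
have [t [t0 Dt]] : exists t : K, t != 0 /\ \det (Nt K id t) != 0.
  apply: contrapT => H; have : \det (Nt _ polyC 'X) = 0.
    apply: poly_vanish => t t0; apply/eqP/negPn/negP => Dt; apply: H; exists t; split=> //.
    by rewrite -NtE det_map_mx.
  move=> D0; have := NtE 0 => /(congr1 determinant); rewrite det_map_mx D0 det0 /=.
  by rewrite /horner_eval horner0 => /eqP; rewrite eq_sym oner_eq0.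
exists t => //.
pose D : 'M[K]_n := diag_mx (\row_i t ^+ w i).
have hA : t ^- c *: (D *m col_mask K A) = T K t *m col_mask K A.
  rewrite /T /col_mask !mulmx_diag; apply/matrixP => i j; rewrite !mxE mulrnAr.
  case: (boolP (A i)) => [/wA wi|]; last by rewrite !mulr0 !mul0rn.
  by rewrite !mulr1 -{1}(subnKC wi) exprD mulKf // expf_neq0.
have hB : t ^- c *: (D *m (S K t *m col_mask K B)) = col_mask K B.
  rewrite /S /col_mask !mulmx_diag; apply/matrixP => i j; rewrite !mxE mulrnAr.
  case: (boolP (B i)) => [/wB wi|]; last by rewrite !mulr0 !mul0rn.
  by rewrite !mulr1 -exprD subnKC ?(ltnW wi) // mulVf // expf_neq0.
have NtU : Nt K id t \in unitmx by rewrite unitmxE unitfE.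
rewrite -(mxrank_unit NtU).
(* The invertible matrix of size [ra + rb] factors through the matrix of the statement and so bounds
   its rank from below. *)
have -> : Nt K id t = block_mx P1 0 0 (t ^- c *: P2) *m col_mx U (W *m D)
    *m row_mx (col_mask K A *m Q1) (S K t *m col_mask K B *m Q2).
  rewrite mul_block_col !mul0mx addr0 add0r mul_col_row /Nt !map_mx_id //.
  congr (block_mx _ _ _ _).
  - by rewrite -PQ1 !mulmxA.
  - by rewrite /X1 /Y2 !mulmxA.
  - rewrite /X2 /Y1 (mulmxA _ (col_mask K A)) -(mulmxA (P2 *m W)) -hA.
    by rewrite -scalemxAr -!scalemxAl !mulmxA.
  - rewrite -PQ2 -[in LHS]hB -!scalemxAl !mulmxA.
    by rewrite -!scalemxAr -!scalemxAl !mulmxA.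
apply: leq_trans (mxrankM_maxl _ _) _; exact: mxrankM_maxr.
Qed.

(** * Cuttings of sets of lattice points by planes *)

Definition Z3 : Type := int * int * int.

Definition dot (a x : Z3) : int := a.1.1 * x.1.1 + a.1.2 * x.1.2 + a.2 * x.2.

Definition sub3 (x y : Z3) : Z3 := (x.1.1 - y.1.1, x.1.2 - y.1.2, x.2 - y.2).

Definition det3 (u v w : Z3) : int :=
  u.1.1 * (v.1.2 * w.2 - v.2 * w.1.2) - u.1.2 * (v.1.1 * w.2 - v.2 * w.1.1)
  + u.2 * (v.1.1 * w.1.2 - v.1.2 * w.1.1).

Definition nondegenerate (p0 p1 p2 p3 : Z3) : bool :=
  det3 (sub3 p1 p0) (sub3 p2 p0) (sub3 p3 p0) != 0.

(* A is cut by successive planes into s pieces; r is the total number of points selected,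
   at most four affinely independent ones in each piece. *)
Inductive tiled : (Z3 -> Prop) -> nat -> nat -> Prop :=
| tiled_none (A : Z3 -> Prop) : tiled A 0 0
| tiled_simplex (A : Z3 -> Prop) (p0 p1 p2 p3 : Z3) (r : nat) :
    (r <= 4)%N -> nondegenerate p0 p1 p2 p3 ->
    (forall k, (k < r)%N -> A (nth p0 [:: p0; p1; p2; p3] k)) -> tiled A 1 r
| tiled_cut (A : Z3 -> Prop) (a : Z3) (c : int) s1 r1 s2 r2 :
    tiled (fun x => A x /\ (dot a x < c)%R) s1 r1 ->
    tiled (fun x => A x /\ (c <= dot a x)%R) s2 r2 ->
    tiled A (s1 + s2) (r1 + r2).

Lemma tiled_sub (A B : Z3 -> Prop) s r : (forall x, A x -> B x) -> tiled A s r -> tiled B s r.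
Proof.
move=> AB tA; elim: tA B AB =>
  {A s r} [A|A p0 p1 p2 p3 r r4 nd Ap|A a c s1 r1 s2 r2 _ IH1 _ IH2] B AB.
- exact: tiled_none.
- by apply: tiled_simplex nd _ => // k kr; apply/AB/Ap.
- apply: (@tiled_cut _ a c); first by apply: IH1 => x [/AB].
  by apply: IH2 => x [/AB].
Qed.

Definition add3 (x y : Z3) : Z3 := (x.1.1 + y.1.1, x.1.2 + y.1.2, x.2 + y.2).

(** The planes move with the points, since [dot a] changes by the constant [dot a b]. *)
Lemma tiled_translate (b : Z3) (A B : Z3 -> Prop) s r :
  (forall x, A x -> B (add3 x b)) -> tiled A s r -> tiled B s r.
Proof.
move=> AB tA; elim: tA B AB =>
  {A s r} [A|A p0 p1 p2 p3 r r4 nd Ap|A a c s1 r1 s2 r2 _ IH1 _ IH2] B AB.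
- exact: tiled_none.
- apply: (@tiled_simplex _ (add3 p0 b) (add3 p1 b) (add3 p2 b) (add3 p3 b)) => //.
    move: nd; rewrite /nondegenerate; congr (_ != _).
    by congr (det3 _ _ _); rewrite /sub3 /add3 /=; congr (_, _, _); ring.
  move=> k kr; have := AB _ (Ap k kr).
  by have : (k < 4)%N by [apply: leq_trans r4]; move: k {kr} => [|[|[|[|]]]].
- have dotD x : dot a (add3 x b) = dot a x + dot a b by rewrite /dot /add3 /=; ring.
  apply: (@tiled_cut _ a (c + dot a b)).
    by apply: IH1 => x [/AB Bx ax]; split=> //; rewrite dotD ltrD2r.
  by apply: IH2 => x [/AB Bx ax]; split=> //; rewrite dotD lerD2r.
Qed.

Lemma det_matrix22 (R : comPzRingType) (f : nat -> nat -> R) :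
  \det (\matrix_(i < 2, j < 2) f i j) = f 0 0 * f 1 1 - f 0 1 * f 1 0.
Proof.
rewrite (expand_det_row _ ord0) !big_ord_recl big_ord0 /cofactor !det_mx11 !mxE /= /bump /=.
by rewrite addn0 expr0 expr1; ring.
Qed.

Lemma det_matrix_expand (R : comPzRingType) n (f : nat -> nat -> R) :
  \det (\matrix_(i < n.+1, j < n.+1) f i j) =
  \sum_(k < n.+1) (-1) ^+ k * f 0 k *
    \det (\matrix_(i < n, j < n) f i.+1 (bump k j)).
Proof.
rewrite (expand_det_row _ ord0); apply: eq_bigr => k _.
rewrite mxE /cofactor add0n mulrA [f _ _ * _]mulrC; congr (_ * \det _).
by apply/matrixP => i j; rewrite !mxE.
Qed.

Lemma det_matrix33 (R : comPzRingType) (f : nat -> nat -> R) :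
  \det (\matrix_(i < 3, j < 3) f i j) =
  f 0 0 * (f 1 1 * f 2 2 - f 1 2 * f 2 1) - f 0 1 * (f 1 0 * f 2 2 - f 1 2 * f 2 0)
  + f 0 2 * (f 1 0 * f 2 1 - f 1 1 * f 2 0).
Proof.
rewrite det_matrix_expand !big_ord_recl big_ord0 /=.
rewrite !(det_matrix22 (fun i j => f i.+1 (bump _ j))) /bump /=.
by rewrite expr0 expr1 sqrrN expr1n; ring.
Qed.

(** * From cuttings to ranks of interpolation conditions *)

Section Soundness.
Variables (K : numFieldType) (n : nat) (e : 'I_n -> Z3).

(** The character of the torus with exponent vector [x]. *)
Definition chi (v : K * K * K) (x : Z3) : K := v.1.1 ^ x.1.1 * v.1.2 ^ x.1.2 * v.2 ^ x.2.

Definition coef (x : Z3) (j : 'I_4) : int := nth 0 [:: 1; x.1.1; x.1.2; x.2] j.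

(* The conditions of vanishing to order two at the point v of the torus, on polynomials
   with exponents e, written with the logarithmic derivatives. *)
Definition condmx (v : K * K * K) : 'M[K]_(4, n) :=
  \matrix_(j, i) ((coef (e i) j)%:~R * chi v (e i)).

Definition conds (vs : seq (K * K * K)) : 'M[K]_n := (\sum_(v <- vs) <<condmx v>>)%MS.

Definition torus (v : K * K * K) := [&& v.1.1 != 0, v.1.2 != 0 & v.2 != 0].

Definition spans (A : Z3 -> Prop) s r := exists vs,
  [/\ size vs = s, all torus vs & (r <= \rank (conds vs *m col_mask K (fun i => `[< A (e i) >])))%N].

(** The action on the torus of the one-parameter subgroup with weight [a]. *)
Definition scale3 (t : K) (a : Z3) (v : K * K * K) : K * K * K :=
  (t ^ a.1.1 * v.1.1, t ^ a.1.2 * v.1.2, t ^ a.2 * v.2).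

Lemma torus_scale3 t a v : t != 0 -> torus v -> torus (scale3 t a v).
Proof. by move=> t0 /and3P[v1 v2 v3]; rewrite /torus /= !mulf_neq0 ?expfz_neq0. Qed.

Lemma chi_scale3 t a v x : t != 0 -> chi (scale3 t a v) x = t ^ dot a x * chi v x.
Proof.
move=> t0; rewrite /chi /dot /= !expfzMl !exprz_exp !expfzDr //; ring.
Qed.

(** Moving the points multiplies the column of exponent [x] by a power of [t] with exponent
    [dot a x]. The shift by [C] makes these exponents natural numbers and only rescales each block
    of conditions. *)
Lemma conds_scale3 t a (C : nat) (w : 'I_n -> nat) vs : t != 0 ->
  (forall i, (w i)%:Z = dot a (e i) + C%:Z) ->
  (conds (map (scale3 t a) vs) :=: conds vs *m diag_mx (\row_i t ^+ w i))%MS.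
Proof.
move=> t0 wE; rewrite /conds.
elim: vs => [|v vs IH] /=; first by rewrite !big_nil mul0mx.
rewrite !big_cons; apply: eqmx_trans (eqmx_sym (addsmxMr _ _ _)).
apply: adds_eqmx IH; apply: eqmx_trans (genmxE _) _.
apply: eqmx_trans (eqmx_sym (eqmxMr _ (genmxE _))).
have -> : condmx (scale3 t a v) = t ^ (- C%:Z) *: (condmx v *m diag_mx (\row_i t ^+ w i)).
  apply/matrixP => j i; rewrite mul_mx_diag !mxE chi_scale3 //.
  rewrite -[t ^+ w i]/(t ^ (w i)%:Z) wE -[in LHS](addrK C%:Z (dot a (e i))).
  by rewrite expfzDr //; ring.
by apply: eqmx_scale; rewrite expfz_neq0.
Qed.

(** The points serving the side [dot a x < c] are moved by the one-parameter subgroup of weight [a];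
    the degeneration then adds the two ranks. *)
Lemma spans_cut A a c s1 r1 s2 r2 :
  spans (fun x => A x /\ (dot a x < c)%R) s1 r1 ->
  spans (fun x => A x /\ (c <= dot a x)%R) s2 r2 ->
  spans A (s1 + s2) (r1 + r2).
Proof.
move=> [vs [sz1 tor1 rk1]] [ws [sz2 tor2 rk2]].
pose C := (\sum_i absz (dot a (e i)))%N.
have Cge i : 0 <= dot a (e i) + C%:Z.
  suff : (absz (dot a (e i)) <= C)%N by lia.
  by rewrite /C (bigD1 i) //= leq_addr.
pose w i := absz (dot a (e i) + C%:Z).
have wE i : (w i)%:Z = dot a (e i) + C%:Z by rewrite /w abszE ger0_norm.
(* The threshold is shifted like the weights and truncated at 0. *)
pose c' := absz (Num.max 0 (c + C%:Z)).
pose mA := col_mask K (fun i => `[< A (e i) >]).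
have maskE (P : Z3 -> Prop) : col_mask K (fun i => `[< A (e i) /\ P (e i) >]) =
    mA *m col_mask K (fun i => `[< P (e i) >]).
  by rewrite mul_mask; congr (col_mask _ _); apply: funext => i /=; rewrite asbool_and.
have [||t t0] := @torus_degeneration K n _ _ (fun i => `[< (c <= dot a (e i))%R >])
   (fun i => `[< (dot a (e i) < c)%R >]) (conds ws *m mA) (conds vs *m mA) w c'.
- move=> i /asboolP ci; have := wE i; have := Cge i; rewrite /c'; lia.
- move=> i /asboolP ci; have := wE i; have := Cge i; rewrite /c'; lia.
rewrite -!mulmxA -(maskE (fun x => (c <= dot a x)%R)) -(maskE (fun x => (dot a x < c)%R)) addnC => rk.
exists (map (scale3 t a) vs ++ ws); split.
- by rewrite size_cat size_map sz1 sz2.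
- rewrite all_cat tor2 andbT all_map; apply: sub_all tor1 => v; exact: torus_scale3.
apply: leq_trans (leq_add rk1 rk2) (leq_trans rk _).
rewrite -addsmxE /mA mask_diagC mulmxA.
rewrite /conds big_cat /= -/(conds _) -/(conds ws).
rewrite (addsmxMr _ _ _) addsmxC.
by rewrite (adds_eqmx (eqmxMr _ (conds_scale3 _ t0 wE)) (eqmx_refl _)).
Qed.
(** At the point (1, 1, 1) all characters are 1, so the column of exponent [x] is the vector (1, x).
    Four such columns have as determinant [det3] of the differences; the first [r] are therefore
    independent, and the remaining points only complete the basis. *)
Lemma spans_simplex (A : Z3 -> Prop) p0 p1 p2 p3 r :
  (r <= 4)%N -> nondegenerate p0 p1 p2 p3 ->
  (forall k, (k < r)%N -> exists2 i, A (e i) & e i = nth p0 [:: p0; p1; p2; p3] k) ->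
  spans A 1 r.
Proof.
move=> r4 nd Ap; pose p k := nth p0 [:: p0; p1; p2; p3] k.
have /choice[ip ipP] : forall k : 'I_r, exists i, A (e i) /\ e i = p k.
  by move=> k; have [i Ai ei] := Ap k (ltn_ord k); exists i.
exists [:: (1, 1, 1)]; split=> //=; first by rewrite /torus !oner_neq0.
set m := col_mask K _.
have conds1 : (conds [:: (1, 1, 1)] *m m :=: condmx (1, 1, 1) *m m)%MS.
  apply: eqmxMr; rewrite /conds big_seq1; exact: genmxE.
rewrite conds1.
pose E : 'M[int]_4 := \matrix_(j, k) coef (p k) j.
have detE : \det E = det3 (sub3 p1 p0) (sub3 p2 p0) (sub3 p3 p0).
  rewrite (det_matrix_expand _ (fun j k => nth 0 [:: 1; (p k).1.1; (p k).1.2; (p k).2] j)).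
  rewrite !big_ord_recl big_ord0 /=.
  rewrite !(det_matrix33 (fun i j => nth 0
    [:: 1; (p (bump _ j)).1.1; (p (bump _ j)).1.2; (p (bump _ j)).2] i.+1)).
  rewrite /p /det3 /sub3 /bump /=.
  by ring.
have Eu : map_mx (fun z : int => z%:~R : K) E \in unitmx.
  rewrite unitmxE unitfE (det_map_mx (intmul 1 : {rmorphism int -> K})) detE intr_eq0.
  exact: nd.
have pidE : map_mx (fun z : int => z%:~R : K) E *m (pid_mx r : 'M_(4, r)) =
    condmx (1, 1, 1) *m m *m (\matrix_(i, k) (i == ip k)%:R : 'M[K]_(n, r)).
  apply/matrixP => j k; rewrite mul_mx_diag !mxE.
  rewrite (bigD1 (widen_ord r4 k)) //= big1 ?addr0 => [|l lk]; last first.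
    rewrite !mxE; case: eqP => [lk'|]; rewrite ?mulr0 //.
    by case/eqP: lk; apply/val_inj.
  rewrite [RHS](bigD1 (ip k)) //= big1 ?addr0 => [|i ik]; last first.
    by rewrite !mxE (negPf ik) mulr0.
  have [Ai ei] := ipP k.
  rewrite !mxE !eqxx /= ltn_ord asboolT // ei /chi /= !exp1rz !mulr1.
  by [].
have rkE : \rank (map_mx (fun z : int => z%:~R : K) E *m (pid_mx r : 'M_(4, r))) = r.
  by rewrite eqmxMfull ?row_full_unit // rank_pid_mx.
apply: (@leq_trans (\rank (map_mx (fun z : int => z%:~R : K) E *m (pid_mx r : 'M_(4, r))))).
  by rewrite rkE.
by rewrite pidE mxrankM_maxl.
Qed.

Lemma tiled_spans A s r : (forall x, A x -> exists i, e i = x) ->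
  tiled A s r -> spans A s r.
Proof.
move=> Ae tA; elim: tA Ae => {A s r} [A|A p0 p1 p2 p3 r r4 nd Ap|A a c s1 r1 s2 r2 _ IH1 _ IH2] Ae.
- by exists [::].
- apply: spans_simplex r4 nd _ => k kr; have Apk := Ap k kr.
  by have [i ei] := Ae _ Apk; exists i; rewrite ei.
- by apply: (@spans_cut _ a c); [apply: IH1 | apply: IH2] => x [/Ae].
Qed.
End Soundness.

(** * Cutting the lattice points of a tetrahedron *)

Definition perfect (A : Z3 -> bool) q := tiled A q (4 * q).

(* For a set A of N points this implies that N %/ 4 double points impose independent
   conditions on the polynomials with exponents in A, and that ceil(N / 4) double points
   impose N conditions. *)
Definition full (A : Z3 -> bool) N :=
  tiled A (N %/ 4) (4 * (N %/ 4)) /\ tiled A ((N + 3) %/ 4) N.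

(** The second part is given up to the translation by [b], so that it can be a smaller shape of the
    same family. *)
Lemma perfect_cut (A A1 A2 : Z3 -> bool) b a c q1 q2 :
  perfect A1 q1 -> (forall x, A1 x -> A x && (dot a x < c)) ->
  perfect A2 q2 -> (forall x, A2 x -> A (add3 x b) && (c <= dot a (add3 x b))) ->
  perfect A (q1 + q2).
Proof.
move=> t1 s1 t2 s2; rewrite /perfect mulnDr; apply: (@tiled_cut _ a c).
  by apply: tiled_sub t1 => x /s1/andP.
by apply: (tiled_translate (b := b)) t2 => x /s2/andP.
Qed.

Lemma full_cut (A A1 A2 : Z3 -> bool) b a c q N :
  perfect A1 q -> (forall x, A1 x -> A x && (dot a x < c)) ->
  full A2 N -> (forall x, A2 x -> A (add3 x b) && (c <= dot a (add3 x b))) ->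
  full A (4 * q + N).
Proof.
move=> t1 s1 [t2 t3] s2.
have cut s r : tiled A2 s r -> tiled A (q + s) (4 * q + r).
  move=> t; apply: (@tiled_cut _ a c).
    by apply: tiled_sub t1 => x /s1/andP.
  by apply: (tiled_translate (b := b)) t => x /s2/andP.
split.
  rewrite (_ : (4 * q + N) %/ 4 = q + N %/ 4)%N; last by lia.
  by rewrite mulnDr; apply: cut.
rewrite (_ : (4 * q + N + 3) %/ 4 = q + (N + 3) %/ 4)%N; last by lia.
exact: cut.
Qed.

Lemma perfect_full A q : perfect A q -> full A (4 * q).
Proof.
move=> t; split; first by rewrite mulKn.
by rewrite (_ : (4 * q + 3) %/ 4 = q)%N; last by lia.
Qed.

(* A plane {a.x = c} cutting off four points, of which the first r are used. *)
Definition piece : Type := Z3 * int * Z3 * Z3 * Z3 * Z3 * nat.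

(** Each piece is tested on what the earlier cuts leave, and by evaluation only. A last piece with
    zero normal and [c = 1] takes all that remains. *)
Fixpoint check_pieces (A : Z3 -> bool) (l : seq piece) : bool :=
  if l is (a, c, p0, p1, p2, p3, r) :: l' then
    [&& (r <= 4)%N, nondegenerate p0 p1 p2 p3,
        all (fun p => A p && (dot a p < c)) (take r [:: p0; p1; p2; p3])
      & check_pieces (fun x => A x && (c <= dot a x)) l']
  else true.

Lemma check_tiled l (A : Z3 -> bool) :
  check_pieces A l -> tiled A (size l) (sumn [seq p.2 | p <- l]).
Proof.
elim: l A => [|[[[[[[a c] p0] p1] p2] p3] r] l IH] A /=; first by move=> _; apply: tiled_none.
move=> /and4P[r4 nd /allP Ap /IH tl]; rewrite -[(size l).+1]add1n.
apply: (@tiled_cut _ a c); last by apply: tiled_sub tl => x /andP.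
apply: (tiled_simplex r4 nd) => k kr.
apply/andP; apply: Ap; rewrite -(nth_take p0 kr) mem_nth //.
by rewrite size_take /=; case: ifP; lia.
Qed.

Lemma check_perfect l (A : Z3 -> bool) :
  check_pieces A l -> all (fun p => p.2 == 4) l -> perfect A (size l).
Proof.
move=> /check_tiled; rewrite /perfect => t l4; rewrite (_ : 4 * size l = sumn [seq p.2 | p <- l])%N //.
by elim: l {t} l4 => //= p l IH /andP[/eqP -> /IH <-]; rewrite mulnS.
Qed.

Definition simplex (d : int) (x : Z3) : bool :=
  [&& 0 <= x.1.1, 0 <= x.1.2, 0 <= x.2 & x.1.1 + x.1.2 + x.2 <= d].

Definition slab d x := simplex d x && (x.2 <= 1).
Definition beam d x := slab d x && (x.1.2 <= 1).

(** The coordinate sum takes the place of the first coordinate, so that the box fits along the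
    slanted face of the tetrahedron. *)
Definition sheared_box (l m n : int) (x : Z3) : bool :=
  [&& 0 <= x.1.1 + x.1.2 + x.2 < l, 0 <= x.1.2 < m & 0 <= x.2 < n].

Lemma perfect_cube : perfect (sheared_box 2 2 2) 2.
Proof.
pose l : seq piece := [::
  ((1, 2, 2), 2, (0, 0, 0), (1, 0, 0), (-1, 1, 0), (-1, 0, 1), 4%N);
  ((0, 0, 0), 1, (0, 1, 0), (0, 0, 1), (-2, 1, 1), (-1, 1, 1), 4%N)]%Z.
by apply: (@check_perfect l); vm_compute.
Qed.

Lemma perfect_beam m : perfect (beam (2 * m + 1)%:Z) (2 * m + 1).
Proof.
elim: m => [|m IH].
  pose l : seq piece := [::
    ((0, 0, 0), 1, (0, 0, 0), (1, 0, 0), (0, 1, 0), (0, 0, 1), 4%N)]%Z.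
  by apply: (@check_perfect l); vm_compute.
rewrite (_ : 2 * m.+1 + 1 = 2 * m + 1 + 2)%N; last by lia.
(* The layers with coordinate sum [2 * m + 2] and [2 * m + 3] form a sheared cube. *)
apply: (@perfect_cut _ _ _ ((2 * m + 2)%:Z, 0, 0) (1, 1, 1) (2 * m + 2)%:Z _ _ IH _ perfect_cube).
  by move=> [[x y] z]; rewrite /beam /slab /simplex /dot /=; lia.
by move=> [[x y] z]; rewrite /beam /slab /simplex /sheared_box /add3 /dot /=; lia.
Qed.

(** Removing a beam leaves a slab of size smaller by 2; the odd numbers of quadruples in the beams
    add up to a square. *)
Lemma perfect_slab m : perfect (slab (2 * m + 1)%:Z) (m.+1 ^ 2).
Proof.
elim: m => [|m IH].
  apply: (@tiled_sub (beam 1)); last exact: (perfect_beam 0).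
  by move=> [[x y] z] /andP[].
rewrite (_ : m.+2 ^ 2 = (2 * m.+1 + 1) + m.+1 ^ 2)%N; last by lia.
apply: (@perfect_cut _ _ _ (0, 2, 0) (0, 1, 0) 2 _ _ (perfect_beam m.+1) _ IH).
  by move=> [[x y] z]; rewrite /beam /slab /simplex /dot /=; lia.
by move=> [[x y] z]; rewrite /slab /simplex /add3 /dot /=; lia.
Qed.

(** Slabs are peeled off in turn, so [q] is the sum of the first [m + 1] squares. *)
Lemma perfect_simplex m : exists2 q, perfect (simplex (2 * m + 1)%:Z) q &
  (6 * q = m.+1 * m.+2 * (2 * m + 3))%N.
Proof.
elim: m => [|m [q tq qE]].
  exists 1%N => //; apply: (@tiled_sub (beam 1)); last exact: (perfect_beam 0).
  by move=> [[x y] z] /andP[/andP[]].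
exists (m.+2 ^ 2 + q)%N; last by rewrite mulnDr qE; lia.
apply: (@perfect_cut _ _ _ (0, 0, 2) (0, 0, 1) 2 _ _ (perfect_slab m.+1) _ tq).
  by move=> [[x y] z]; rewrite /slab /simplex /dot /=; lia.
by move=> [[x y] z]; rewrite /simplex /add3 /dot /=; lia.
Qed.

Definition frustum d x := simplex d x && (x.2 <= 2).
Definition wedge d x := frustum d x && (x.1.2 < 8).

(* The cuttings below were found by a random search. *)
Definition cert_box : seq piece := [::
  ((-2, 1, 0), 2, (1, 0, 0), (0, 0, 0), (0, 0, 1), (0, 1, 0), 4%N);
  ((1, -2, -2), -11, (-5, 3, 2), (-4, 3, 2), (-4, 2, 2), (-4, 3, 1), 4%N);
  ((0, 2, 1), 3, (-1, 0, 1), (-2, 0, 2), (-1, 0, 2), (-1, 1, 0), 4%N);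
  ((-1, -2, 0), -2, (-2, 3, 0), (-1, 2, 0), (-3, 3, 0), (-3, 3, 1), 4%N);
  ((-1, 0, 1), 4, (-2, 2, 0), (-1, 1, 1), (-2, 2, 1), (-2, 1, 1), 4%N);
  ((0, 0, 0), 1, (-3, 2, 1), (-2, 1, 2), (-3, 2, 2), (-3, 1, 2), 4%N)]%Z.

Definition cert_wedge : seq piece := [::
  ((-2, 1, 0), -16, (10, 0, 0), (9, 0, 0), (9, 0, 1), (9, 1, 0), 4%N);
  ((1, 1, -1), 0, (0, 0, 2), (1, 0, 2), (0, 0, 1), (0, 1, 2), 4%N);
  ((-1, -2, 0), -15, (3, 7, 0), (2, 7, 1), (2, 7, 0), (4, 6, 0), 4%N);
  ((1, -2, -2), -15, (0, 7, 2), (1, 7, 2), (0, 7, 1), (0, 6, 2), 4%N);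
  ((-2, -1, 0), -16, (8, 2, 0), (7, 3, 0), (8, 1, 1), (8, 1, 0), 4%N);
  ((2, -1, -2), -7, (0, 5, 2), (1, 6, 2), (0, 6, 1), (0, 4, 2), 4%N);
  ((-1, 0, -1), -8, (8, 0, 2), (7, 1, 2), (7, 0, 2), (8, 0, 1), 4%N);
  ((2, 1, -2), 0, (0, 2, 2), (1, 1, 2), (0, 3, 2), (0, 1, 1), 4%N);
  ((2, -2, -1), -11, (0, 7, 0), (1, 7, 1), (0, 6, 0), (1, 7, 0), 4%N);
  ((-1, 1, -2), -8, (6, 0, 2), (5, 0, 2), (6, 1, 2), (7, 0, 1), 4%N);
  ((1, -2, 1), -9, (1, 6, 0), (1, 6, 1), (2, 6, 0), (0, 5, 0), 4%N);
  ((2, 2, 0), 4, (0, 0, 0), (0, 1, 0), (1, 0, 0), (1, 0, 1), 4%N);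
  ((2, 1, 1), 4, (0, 2, 0), (0, 2, 1), (1, 1, 0), (0, 3, 0), 4%N);
  ((-2, 2, -1), -12, (8, 0, 0), (7, 0, 0), (6, 0, 1), (7, 1, 1), 4%N);
  ((2, -1, 1), -2, (0, 4, 0), (0, 5, 1), (0, 4, 1), (1, 5, 0), 4%N);
  ((-2, 1, 0), -11, (7, 1, 0), (6, 0, 0), (7, 2, 0), (7, 2, 1), 4%N);
  ((-2, -1, 0), -14, (6, 4, 0), (6, 3, 0), (6, 3, 1), (5, 5, 0), 4%N);
  ((1, -2, -2), -11, (2, 6, 2), (1, 5, 2), (2, 6, 1), (2, 5, 2), 4%N);
  ((-1, 2, -2), -6, (4, 0, 2), (5, 1, 2), (3, 0, 2), (5, 0, 1), 4%N);
  ((-2, -1, -1), -14, (6, 2, 2), (6, 2, 1), (5, 3, 2), (5, 4, 1), 4%N);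
  ((-2, 1, 1), -9, (6, 1, 0), (6, 1, 1), (6, 2, 0), (5, 0, 0), 4%N);
  ((-2, 1, 1), -7, (5, 1, 0), (5, 1, 1), (5, 2, 0), (4, 0, 0), 4%N);
  ((-2, 1, -1), -8, (5, 2, 2), (5, 2, 1), (4, 0, 1), (4, 1, 2), 4%N);
  ((-1, 2, 1), -1, (3, 0, 0), (4, 1, 0), (3, 0, 1), (2, 0, 0), 4%N);
  ((-1, -2, -1), -14, (3, 6, 1), (4, 5, 1), (3, 5, 2), (3, 6, 0), 4%N);
  ((0, 2, -2), 0, (2, 0, 2), (3, 1, 2), (2, 1, 2), (2, 0, 1), 4%N);
  ((2, 1, -2), 2, (1, 2, 2), (1, 1, 1), (1, 3, 2), (0, 3, 1), 4%N);
  ((-2, 1, -2), -8, (4, 2, 2), (4, 1, 1), (4, 3, 2), (5, 3, 1), 4%N);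
  ((-1, 2, 1), 1, (3, 1, 0), (3, 1, 1), (4, 2, 0), (2, 1, 0), 4%N);
  ((2, -1, 2), 0, (1, 4, 0), (1, 3, 0), (2, 5, 0), (1, 5, 1), 4%N);
  ((-1, 2, -2), -1, (3, 2, 2), (2, 1, 1), (2, 2, 2), (4, 2, 1), 4%N);
  ((2, -2, -1), -5, (1, 4, 2), (1, 4, 1), (2, 5, 1), (2, 4, 2), 4%N);
  ((2, 0, -1), 3, (1, 3, 1), (1, 2, 1), (2, 3, 2), (1, 2, 0), 4%N);
  ((2, 2, -1), 10, (2, 2, 1), (2, 2, 0), (2, 3, 1), (3, 2, 1), 4%N);
  ((1, 0, -2), 1, (3, 3, 2), (3, 4, 2), (2, 4, 1), (4, 4, 2), 4%N);
  ((1, 2, -2), 9, (3, 3, 1), (3, 2, 0), (2, 3, 0), (4, 3, 1), 4%N);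
  ((1, -2, 0), -5, (3, 5, 1), (3, 5, 0), (2, 4, 0), (4, 5, 0), 4%N);
  ((1, -1, 1), 1, (3, 4, 0), (3, 4, 1), (4, 4, 0), (3, 3, 0), 4%N);
  ((0, 0, 0), 1, (4, 4, 1), (5, 4, 0), (4, 3, 0), (5, 3, 0), 4%N)]%Z.

Definition cert_frustum6 : seq piece := [::
  ((1, -2, 0), -8, (0, 6, 0), (0, 5, 0), (0, 5, 1), (1, 5, 0), 4%N);
  ((-2, 1, 1), -8, (6, 0, 0), (5, 0, 0), (5, 1, 0), (5, 0, 1), 4%N);
  ((-1, -2, 0), -8, (2, 4, 0), (3, 3, 0), (1, 4, 0), (1, 4, 1), 4%N);
  ((1, 1, -1), 0, (0, 0, 2), (0, 1, 2), (1, 0, 2), (0, 0, 1), 4%N);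
  ((0, -1, -1), -4, (0, 4, 2), (0, 3, 2), (1, 3, 2), (0, 4, 1), 4%N);
  ((1, -2, 1), -4, (0, 4, 0), (0, 3, 0), (0, 3, 1), (1, 3, 0), 4%N);
  ((-1, -2, 1), -6, (2, 3, 0), (4, 2, 0), (2, 3, 1), (3, 2, 0), 4%N);
  ((1, -2, -1), -4, (1, 3, 1), (0, 2, 2), (0, 2, 1), (1, 2, 2), 4%N);
  ((-1, 1, 1), -2, (4, 0, 0), (4, 1, 0), (3, 0, 0), (4, 0, 1), 4%N);
  ((-1, 1, 0), -2, (4, 0, 2), (4, 1, 1), (3, 0, 1), (3, 0, 2), 4%N);
  ((-1, -1, -2), -6, (3, 1, 2), (2, 2, 2), (3, 2, 1), (2, 1, 2), 4%N);
  ((0, 2, -2), 0, (2, 0, 2), (1, 1, 2), (2, 0, 1), (1, 0, 1), 4%N);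
  ((1, 1, 0), 2, (0, 0, 0), (0, 1, 1), (1, 0, 0), (0, 1, 0), 4%N);
  ((-2, 1, 2), -2, (3, 1, 0), (2, 0, 0), (2, 1, 0), (3, 1, 1), 4%N);
  ((-1, -2, -2), -5, (2, 2, 1), (1, 2, 1), (2, 2, 0), (2, 1, 1), 4%N);
  ((0, 0, 0), 1, (1, 2, 0), (1, 1, 1), (0, 2, 0), (1, 1, 0), 4%N)]%Z.

Definition cert_frustum8 : seq piece := [::
  ((0, -2, 1), -12, (0, 8, 0), (0, 7, 0), (1, 7, 0), (0, 7, 1), 4%N);
  ((1, 1, 1), 2, (0, 0, 0), (0, 1, 0), (1, 0, 0), (0, 0, 1), 4%N);
  ((2, 1, 2), 4, (0, 2, 0), (1, 1, 0), (0, 1, 1), (0, 3, 0), 4%N);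
  ((2, -2, 2), -8, (0, 6, 0), (0, 5, 0), (1, 6, 0), (0, 6, 1), 4%N);
  ((1, -2, -2), -12, (0, 6, 2), (0, 5, 2), (1, 6, 1), (1, 5, 2), 4%N);
  ((2, -1, 1), -2, (0, 5, 1), (0, 4, 0), (0, 4, 1), (1, 5, 0), 4%N);
  ((-2, 1, 0), -12, (8, 0, 0), (7, 0, 0), (7, 0, 1), (7, 1, 0), 4%N);
  ((2, 2, 0), 4, (0, 0, 2), (1, 0, 1), (1, 0, 2), (0, 1, 2), 4%N);
  ((1, -1, -1), -4, (0, 4, 2), (0, 3, 2), (1, 4, 2), (1, 5, 1), 4%N);
  ((0, -2, 1), -8, (2, 6, 0), (2, 5, 0), (3, 5, 0), (2, 5, 1), 4%N);
  ((1, 2, -1), 2, (2, 0, 2), (1, 1, 2), (2, 0, 1), (3, 0, 2), 4%N);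
  ((-2, 2, 2), -8, (6, 0, 0), (5, 0, 0), (6, 0, 1), (6, 1, 0), 4%N);
  ((-2, 2, 0), -8, (6, 0, 2), (5, 0, 1), (6, 1, 1), (5, 0, 2), 4%N);
  ((-1, 2, 1), -2, (4, 0, 0), (5, 1, 0), (4, 0, 1), (3, 0, 0), 4%N);
  ((-1, 1, -1), -4, (4, 0, 2), (5, 1, 2), (5, 1, 1), (4, 1, 2), 4%N);
  ((-1, 0, 0), -4, (6, 2, 0), (5, 2, 1), (5, 2, 0), (5, 3, 0), 4%N);
  ((-1, 2, 0), -1, (3, 0, 1), (4, 1, 1), (4, 1, 0), (2, 0, 0), 4%N);
  ((-1, 2, -1), -1, (3, 1, 2), (3, 1, 1), (4, 2, 2), (2, 1, 2), 4%N);
  ((-1, 2, -2), -1, (3, 2, 2), (4, 2, 1), (2, 1, 1), (2, 2, 2), 4%N);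
  ((-2, 1, 0), -4, (4, 2, 0), (3, 1, 0), (4, 3, 1), (4, 3, 0), 4%N);
  ((-2, 2, -1), -1, (3, 2, 1), (3, 2, 0), (3, 3, 2), (2, 1, 0), 4%N);
  ((2, 2, -2), 4, (0, 2, 2), (1, 1, 1), (1, 2, 2), (0, 2, 1), 4%N);
  ((1, 2, 2), 8, (1, 2, 0), (2, 2, 0), (1, 2, 1), (1, 3, 0), 4%N);
  ((1, 2, 0), 8, (0, 3, 1), (2, 2, 1), (1, 3, 1), (1, 3, 2), 4%N);
  ((-2, 2, -1), 1, (3, 3, 1), (2, 3, 2), (3, 3, 0), (4, 4, 0), 4%N);
  ((-2, 1, 2), 1, (3, 4, 0), (2, 3, 0), (3, 4, 1), (2, 4, 0), 4%N);
  ((-2, 1, -2), 2, (2, 4, 2), (2, 3, 1), (2, 4, 1), (1, 4, 1), 4%N);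
  (* The 109 points are 27 quadruples and this one; the last three entries only complete a
     nondegenerate simplex. *)
  ((0, 0, 0), 1, (1, 4, 0), (0, 0, 0), (0, 0, 1), (0, 1, 0), 1%N)]%Z.

Definition cert_frustum10 : seq piece := [::
  ((1, -2, 0), -16, (0, 10, 0), (0, 9, 0), (0, 9, 1), (1, 9, 0), 4%N);
  ((2, 2, -2), 0, (0, 0, 2), (0, 1, 2), (0, 0, 1), (1, 0, 2), 4%N);
  ((-2, 1, 0), -16, (10, 0, 0), (9, 0, 1), (9, 0, 0), (9, 1, 0), 4%N);
  ((1, -1, 1), -6, (0, 8, 0), (1, 8, 0), (0, 7, 0), (0, 8, 1), 4%N);
  ((-2, 2, 2), -12, (8, 0, 0), (8, 1, 0), (7, 0, 0), (8, 0, 1), 4%N);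
  ((0, -2, -2), -16, (0, 8, 2), (1, 8, 1), (1, 7, 2), (0, 7, 2), 4%N);
  ((-2, 1, -2), -16, (8, 0, 2), (7, 0, 2), (7, 1, 2), (8, 1, 1), 4%N);
  ((1, -2, 0), -12, (2, 8, 0), (0, 7, 1), (1, 7, 1), (1, 7, 0), 4%N);
  ((2, -2, -2), -12, (0, 6, 2), (0, 6, 1), (1, 6, 2), (0, 5, 2), 4%N);
  ((1, 2, -2), 0, (2, 0, 2), (1, 1, 2), (1, 0, 1), (3, 0, 2), 4%N);
  ((1, 2, -1), 2, (0, 0, 0), (0, 1, 1), (2, 0, 1), (1, 0, 0), 4%N);
  ((2, -1, -2), -6, (0, 4, 2), (0, 3, 2), (1, 5, 2), (0, 5, 1), 4%N);
  ((-1, 2, 2), -4, (6, 0, 0), (5, 0, 0), (7, 0, 1), (7, 1, 0), 4%N);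
  ((0, -1, -2), -8, (2, 6, 2), (3, 5, 2), (2, 5, 2), (2, 7, 1), 4%N);
  ((-1, -2, -1), -15, (3, 7, 0), (3, 6, 1), (2, 7, 0), (4, 6, 0), 4%N);
  ((2, 2, -1), 4, (0, 2, 2), (0, 1, 0), (0, 2, 1), (1, 1, 1), 4%N);
  ((2, -2, -1), -9, (0, 6, 0), (1, 6, 1), (0, 5, 0), (1, 6, 0), 4%N);
  ((2, -1, 1), -2, (0, 4, 0), (0, 4, 1), (1, 5, 0), (0, 3, 0), 4%N);
  ((2, -1, -2), -4, (1, 4, 2), (1, 5, 1), (0, 3, 1), (1, 3, 2), 4%N);
  ((1, -2, 1), -7, (2, 6, 0), (2, 6, 1), (3, 6, 0), (2, 5, 0), 4%N);
  ((2, -1, 1), 0, (1, 4, 0), (0, 2, 0), (1, 4, 1), (1, 3, 0), 4%N);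
  ((2, 1, -2), 3, (1, 2, 2), (2, 1, 2), (1, 2, 1), (2, 2, 2), 4%N);
  ((1, -1, -2), -4, (2, 4, 2), (2, 3, 2), (3, 4, 2), (2, 5, 1), 4%N);
  ((1, -2, -1), -6, (3, 5, 1), (2, 4, 1), (4, 5, 1), (3, 5, 0), 4%N);
  ((1, 2, -2), 2, (4, 0, 2), (3, 1, 2), (3, 0, 1), (5, 0, 2), 4%N);
  ((2, -1, -1), 1, (1, 3, 1), (1, 2, 0), (2, 3, 1), (2, 4, 0), 4%N);
  ((-1, 1, -1), -6, (6, 0, 2), (6, 1, 2), (6, 0, 1), (7, 1, 1), 4%N);
  ((1, -2, 0), -4, (4, 5, 0), (3, 4, 1), (5, 5, 0), (3, 4, 0), 4%N);
  ((2, -1, 0), 3, (2, 3, 0), (1, 1, 0), (2, 2, 1), (2, 2, 0), 4%N);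
  ((1, -2, -2), -5, (4, 4, 2), (3, 3, 2), (4, 4, 1), (4, 3, 2), 4%N);
  ((1, 1, 0), 4, (2, 0, 0), (2, 1, 1), (2, 1, 0), (3, 0, 0), 4%N);
  ((2, -2, -1), 1, (3, 3, 1), (3, 2, 2), (3, 3, 0), (4, 4, 0), 4%N);
  ((2, 1, 1), 9, (3, 1, 0), (3, 2, 0), (3, 1, 1), (4, 0, 0), 4%N);
  ((1, 1, -2), 3, (4, 1, 2), (4, 0, 1), (4, 2, 2), (5, 1, 2), 4%N);
  ((1, -2, -1), -2, (5, 4, 1), (5, 3, 2), (4, 3, 1), (5, 4, 0), 4%N);
  ((-1, -1, -2), -10, (6, 2, 2), (5, 2, 2), (6, 3, 1), (7, 2, 1), 4%N);
  ((2, -2, -2), 4, (3, 2, 1), (5, 3, 1), (4, 2, 1), (4, 3, 0), 4%N);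
  ((1, 2, -1), 7, (5, 0, 1), (4, 1, 1), (5, 1, 1), (4, 1, 0), 4%N);
  ((2, 1, 0), 13, (4, 2, 0), (5, 1, 0), (5, 2, 1), (5, 2, 0), 4%N);
  ((2, -2, -2), 8, (5, 3, 0), (6, 4, 0), (6, 2, 1), (6, 3, 0), 4%N);
  ((1, 2, -1), 12, (6, 1, 1), (6, 1, 0), (6, 2, 0), (7, 2, 0), 4%N);
  ((0, 0, 0), 1, (8, 2, 0), (7, 3, 0), (0, 0, 0), (0, 0, 1), 2%N)]%Z.

Definition cert_frustum12 : seq piece := [::
  ((1, 1, -1), 0, (0, 0, 2), (0, 0, 1), (0, 1, 2), (1, 0, 2), 4%N);
  ((0, -2, 1), -20, (0, 12, 0), (0, 11, 0), (1, 11, 0), (0, 11, 1), 4%N);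
  ((2, 1, -2), 0, (0, 2, 2), (0, 3, 2), (0, 1, 1), (1, 1, 2), 4%N);
  ((1, 1, 0), 2, (0, 0, 0), (1, 0, 1), (0, 1, 0), (1, 0, 0), 4%N);
  ((1, -1, 1), -8, (0, 10, 0), (0, 9, 0), (0, 10, 1), (1, 10, 0), 4%N);
  ((-2, 0, 1), -20, (12, 0, 0), (11, 1, 0), (11, 0, 0), (11, 0, 1), 4%N);
  ((-2, -1, 0), -20, (10, 2, 0), (10, 1, 0), (10, 1, 1), (9, 3, 0), 4%N);
  ((2, -1, 2), -6, (0, 8, 0), (1, 9, 0), (0, 9, 1), (0, 7, 0), 4%N);
  ((0, -1, 1), -8, (2, 10, 0), (1, 10, 1), (2, 9, 0), (3, 9, 0), 4%N);
  ((-1, 0, -1), -10, (10, 0, 2), (9, 1, 2), (10, 0, 1), (9, 0, 2), 4%N);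
  ((2, 1, 1), 4, (0, 2, 0), (0, 2, 1), (1, 1, 0), (0, 3, 0), 4%N);
  ((-1, 1, -2), -10, (8, 0, 2), (7, 0, 2), (8, 1, 2), (9, 0, 1), 4%N);
  ((1, -2, 0), -16, (0, 10, 2), (0, 9, 2), (1, 9, 2), (1, 9, 1), 4%N);
  ((-2, 1, 0), -16, (10, 0, 0), (9, 0, 0), (9, 1, 1), (9, 1, 0), 4%N);
  ((1, -2, 2), -13, (1, 8, 0), (2, 8, 0), (2, 9, 1), (0, 8, 1), 4%N);
  ((2, -1, 2), -4, (0, 6, 0), (1, 7, 0), (0, 7, 1), (0, 5, 0), 4%N);
  ((2, -2, -1), -14, (0, 8, 2), (0, 7, 2), (1, 8, 2), (1, 8, 1), 4%N);
  ((2, -1, -1), -6, (0, 6, 2), (1, 7, 2), (0, 6, 1), (0, 5, 2), 4%N);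
  ((1, -2, 2), -11, (3, 8, 0), (2, 8, 1), (2, 7, 0), (4, 8, 0), 4%N);
  ((1, -1, -1), -6, (2, 8, 2), (1, 7, 1), (2, 7, 2), (1, 6, 2), 4%N);
  ((1, -2, 1), -10, (3, 8, 1), (2, 7, 1), (1, 6, 0), (3, 7, 0), 4%N);
  ((1, -2, -1), -11, (3, 7, 2), (1, 6, 1), (3, 7, 1), (2, 6, 2), 4%N);
  ((-1, -2, 0), -17, (5, 7, 0), (4, 7, 1), (4, 7, 0), (6, 6, 0), 4%N);
  ((2, -1, 1), -2, (0, 5, 1), (0, 4, 0), (1, 5, 0), (0, 4, 1), 4%N);
  ((-1, -2, -2), -18, (4, 6, 2), (3, 6, 2), (5, 6, 1), (5, 5, 2), 4%N);
  ((2, -1, 0), -2, (0, 4, 2), (1, 5, 2), (1, 5, 1), (0, 3, 1), 4%N);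
  ((2, -2, -1), -7, (2, 6, 1), (2, 6, 0), (1, 4, 2), (2, 5, 2), 4%N);
  ((2, -1, -2), -3, (1, 3, 2), (1, 4, 1), (2, 4, 2), (1, 2, 2), 4%N);
  ((1, -2, 1), -7, (3, 6, 0), (3, 6, 1), (2, 5, 0), (4, 6, 0), 4%N);
  ((2, -1, 0), 0, (1, 4, 0), (2, 5, 1), (1, 3, 0), (1, 3, 1), 4%N);
  ((0, -2, -1), -11, (4, 6, 1), (3, 5, 2), (4, 5, 2), (5, 6, 0), 4%N);
  ((1, -2, 1), -5, (3, 5, 0), (3, 5, 1), (4, 5, 0), (2, 4, 0), 4%N);
  ((2, -1, 1), 2, (1, 2, 0), (2, 4, 1), (2, 3, 0), (1, 2, 1), 4%N);
  ((-1, -2, 0), -15, (7, 5, 0), (6, 5, 0), (6, 5, 1), (8, 4, 0), 4%N);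
  ((2, 1, -1), 4, (1, 1, 1), (2, 0, 2), (2, 1, 2), (2, 0, 1), 4%N);
  ((1, -2, -2), -7, (3, 4, 2), (2, 3, 2), (4, 4, 2), (4, 5, 1), 4%N);
  ((-2, -1, -1), -19, (9, 2, 1), (8, 2, 2), (8, 3, 1), (9, 2, 0), 4%N);
  ((-2, 2, 1), -13, (8, 0, 0), (8, 0, 1), (8, 1, 0), (7, 0, 0), 4%N);
  ((-2, 1, 0), -13, (8, 1, 1), (7, 0, 1), (8, 2, 0), (8, 2, 1), 4%N);
  ((-2, -1, -2), -19, (7, 3, 2), (7, 2, 2), (7, 4, 1), (6, 4, 2), 4%N);
  ((-2, 1, -2), -14, (7, 1, 2), (6, 0, 2), (7, 1, 1), (6, 1, 2), 4%N);
  ((2, 1, -2), 4, (3, 0, 2), (2, 2, 2), (3, 1, 2), (2, 1, 1), 4%N);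
  ((2, -2, -1), -1, (2, 3, 1), (3, 4, 1), (3, 3, 2), (3, 4, 0), 4%N);
  ((2, -1, -1), 3, (2, 2, 1), (3, 3, 1), (3, 2, 2), (2, 2, 0), 4%N);
  ((-1, 2, 1), -4, (6, 0, 0), (5, 0, 0), (6, 0, 1), (7, 1, 0), 4%N);
  ((1, 1, 0), 4, (2, 0, 0), (3, 0, 0), (3, 0, 1), (2, 1, 0), 4%N);
  ((-1, 2, -2), -6, (5, 0, 2), (4, 0, 2), (5, 0, 1), (5, 1, 2), 4%N);
  ((1, 2, -1), 5, (4, 0, 1), (4, 1, 2), (4, 0, 0), (3, 1, 1), 4%N);
  ((-1, 2, 1), -2, (6, 1, 0), (6, 1, 1), (5, 1, 0), (7, 2, 0), 4%N);
  ((-1, 2, -2), -4, (6, 2, 2), (5, 1, 1), (7, 2, 1), (5, 2, 2), 4%N);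
  ((1, 1, -2), 4, (4, 2, 2), (4, 1, 1), (4, 3, 2), (3, 2, 1), 4%N);
  ((-1, 0, 0), -6, (8, 3, 0), (7, 3, 1), (7, 3, 0), (7, 4, 0), 4%N);
  ((-1, -2, -1), -14, (5, 5, 1), (6, 4, 1), (5, 4, 2), (5, 5, 0), 4%N);
  ((-1, 0, -1), -6, (6, 3, 2), (6, 3, 1), (5, 3, 2), (6, 2, 1), 4%N);
  ((-2, -2, 0), -16, (6, 4, 0), (5, 4, 1), (6, 3, 0), (5, 4, 0), 4%N);
  ((1, -2, -1), -2, (4, 4, 1), (4, 4, 0), (4, 3, 1), (3, 3, 0), 4%N);
  ((-2, -1, -1), -12, (5, 3, 1), (6, 2, 0), (5, 3, 0), (5, 2, 1), 4%N);
  ((-1, -2, -2), -7, (4, 3, 0), (4, 2, 1), (5, 2, 0), (4, 2, 0), 4%N);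
  ((0, 0, 0), 1, (3, 2, 0), (4, 1, 0), (3, 1, 0), (0, 0, 1), 3%N)]%Z.

Lemma perfect_box : perfect (sheared_box 2 4 3) 6.
Proof. by apply: (@check_perfect cert_box); vm_compute. Qed.

Lemma perfect_box2 : perfect (sheared_box 2 8 3) 12.
Proof.
apply: (@perfect_cut _ _ _ (-4, 4, 0) (0, 1, 0) 4 6 6 perfect_box _ perfect_box).
  by move=> [[x y] z]; rewrite /sheared_box /dot /=; lia.
by move=> [[x y] z]; rewrite /sheared_box /add3 /dot /=; lia.
Qed.

(** The layers with coordinate sum [2 * m + 11] and [2 * m + 12] form a whole box of 48 points,
    because the last two coordinates add up to at most 9. *)
Lemma perfect_wedge m : perfect (wedge (2 * m + 10)%:Z) (12 * m + 39).
Proof.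
elim: m => [|m IH]; first by apply: (@check_perfect cert_wedge); vm_compute.
rewrite (_ : 12 * m.+1 + 39 = 12 * m + 39 + 12)%N; last by lia.
apply: (@perfect_cut _ _ _ ((2 * m + 11)%:Z, 0, 0) (1, 1, 1) (2 * m + 11)%:Z _ _ IH _ perfect_box2).
  by move=> [[x y] z]; rewrite /wedge /frustum /simplex /dot /=; lia.
by move=> [[x y] z]; rewrite /wedge /frustum /simplex /sheared_box /add3 /dot /=; lia.
Qed.

Lemma check_cat l l' (A : Z3 -> bool) : check_pieces A (l ++ l') -> check_pieces A l.
Proof.
elim: l A => //= [[[[[[[a c] p0] p1] p2] p3] r] l IH] A.
by move=> /and4P[-> -> -> /IH ->].
Qed.

(** Omitting the incomplete last piece gives the first half of [full], keeping it gives the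
    second. *)
Lemma check_full l (A : Z3 -> bool) q r : check_pieces A l ->
  [seq p.2 | p <- l] == rcons (nseq q 4%N) r -> (0 < r < 4)%N -> full A (4 * q + r).
Proof.
move=> chk /eqP lE r4; have szl : size l = q.+1 by rewrite -(size_map snd) lE size_rcons size_nseq.
split.
  rewrite (_ : (4 * q + r) %/ 4 = q)%N; last by lia.
  apply: (@tiled_sub A) => //.
  have /check_perfect : check_pieces A (take q l).
    by apply: (@check_cat _ (drop q l)); rewrite cat_take_drop.
  rewrite size_take szl ltnSn; apply.
  rewrite -(all_map snd (pred1 4%N)) map_take lE -cats1 take_cat size_nseq ltnn subnn take0 cats0.
  by apply/all_pred1P; rewrite size_nseq.
rewrite (_ : (4 * q + r + 3) %/ 4 = q.+1)%N; last by lia.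
have := check_tiled chk; rewrite lE szl -cats1 sumn_cat sumn_nseq /=.
by rewrite addn0.
Qed.

(** With [d = 2 * m + 6] the two lower layers have (d+1)^2 points and the third d(d-1)/2. Cutting
    off the wedge lowers [d] by 8, hence [m] by 4, which leaves four base cases. *)
Lemma full_frustum m :
  full (frustum (2 * m + 6)%:Z) ((2 * m + 7) ^ 2 + (m + 3) * (2 * m + 5)).
Proof.
have [k] := ubnP m; elim: k m => // k IH [|[|[|[|m]]]] mk.
- by apply: (@perfect_full _ 16); apply: (@check_perfect cert_frustum6); vm_compute.
- by apply: (@check_full cert_frustum8 _ 27 1); vm_compute.
- by apply: (@check_full cert_frustum10 _ 41 2); vm_compute.
- by apply: (@check_full cert_frustum12 _ 58 3); vm_compute.
have IHm := IH m ltac:(lia).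
rewrite (_ : ((2 * m.+4 + 7) ^ 2 + (m.+4 + 3) * (2 * m.+4 + 5) =
    4 * (12 * m.+2 + 39) + ((2 * m + 7) ^ 2 + (m + 3) * (2 * m + 5)))%N); last by lia.
apply: (@full_cut _ _ _ (0, 8, 0) (0, 1, 0) 8 _ _ (perfect_wedge m.+2) _ IHm).
  by move=> [[x y] z]; rewrite /wedge /frustum /simplex /dot /=; lia.
by move=> [[x y] z]; rewrite /frustum /simplex /add3 /dot /=; lia.
Qed.

Lemma bin3 d : ('C(d + 3, 3) * 6 = (d + 3) * (d + 2) * (d + 1))%N.
Proof.
by rewrite -[6%N]/(3`!) bin_ffact /falling_factorial /= /ffact_rec; lia.
Qed.

Lemma full_simplex d : (5 <= d)%N -> full (simplex d%:Z) 'C(d + 3, 3).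
Proof.
move=> d5; have bd := bin3 d.
have [m [dE|dE]] : exists m, d = (2 * m + 1)%N \/ d = (2 * m)%N.
  by exists d./2; lia.
  have [q tq qE] := perfect_simplex m.
  rewrite dE (_ : 'C(_, _) = 4 * q)%N; first exact: perfect_full.
  by rewrite -dE; nia.
(* Now [d = 2 * m' + 6], and the layers above [x_3 = 2] form a tetrahedron of odd size [d - 3]. *)
have [m' m'E] : exists m', m = (m' + 3)%N by exists (m - 3)%N; lia.
have [q tq qE] := perfect_simplex m'.+1.
have shifted : perfect (fun x => simplex (2 * m'.+1 + 1)%:Z (add3 x (0, 0, -3))) q.
  apply: (tiled_translate (b := (0, 0, 3))) tq => [[[x y] z]].
  by rewrite /simplex /add3 /=; lia.
rewrite (_ : 'C(_, _) = 4 * q + ((2 * m' + 7) ^ 2 + (m' + 3) * (2 * m' + 5)))%N; last by nia.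
(* The normal points downwards because [full_cut] has its perfect part on the side [dot a x < c]. *)
apply: (@full_cut _ _ _ (0, 0, 0) (0, 0, -1) (-2) _ _ shifted _ (full_frustum m')).
  by move=> [[x y] z]; rewrite /simplex /add3 /dot /=; lia.
by move=> [[x y] z]; rewrite /frustum /simplex /add3 /dot /=; lia.
Qed.

(** * Chains of irreducible closed sets *)

Local Open Scope classical_set_scope.

Section Loci.
Variables (K : numFieldType) (N : nat).
Implicit Types (f g : {mpoly K[N.+1]}) (v w : 'rV[K]_N.+1) (q : pspace K N).

Definition vanishes_on f (Z : set (pspace K N)) :=
  forall q, Z q -> forall v, v \in val q -> f.@[v 0] = 0.

Lemma pspaceP q : exists2 w, w != 0 & val q = <[w]>%VS.
Proof.
case: q => L /= L1; exists (vpick L); first by rewrite vpick0 -dimv_eq0 (eqP L1).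
apply/eqP; rewrite eq_sym eqEdim -memvE memv_pick dim_vline vpick0 -dimv_eq0 (eqP L1).
by [].
Qed.

Lemma dim_line w : w != 0 -> \dim <[w]>%VS == 1%N.
Proof. by rewrite dim_vline => ->. Qed.

Definition pt w (w0 : w != 0) : pspace K N := exist _ <[w]>%VS (dim_line w0).

Lemma meval_line_pt f w : exists r : {poly K}, forall t, r.[t] = f.@[(t *: w) 0].
Proof.
have [r rE] := meval_line f (fun i => w 0 i *: 'X).
by exists r => t; rewrite rE; apply: meval_eq => i; rewrite mxE hornerZ hornerX mulrC.
Qed.

(** Restricted to a line both polynomials become univariate, and [K[t]] is a domain. *)
Lemma line_prime f g q : (forall v, v \in val q -> f.@[v 0] * g.@[v 0] = 0) ->
  (forall v, v \in val q -> f.@[v 0] = 0) \/ (forall v, v \in val q -> g.@[v 0] = 0).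
Proof.
have [w _ ->] := pspaceP q => fg0.
have [a aE] := meval_line_pt f w; have [b bE] := meval_line_pt g w.
have : a * b = 0.
  by apply: poly_vanish => t _; rewrite hornerM aE bE fg0 // memvZ // memv_line.
move/eqP; rewrite mulf_eq0 => /orP[/eqP a0|/eqP b0]; [left|right] => v /vlineP[t ->].
  by rewrite -aE a0 horner0.
by rewrite -bE b0 horner0.
Qed.

Lemma vanishes_pihomog f Z : vanishes_on f Z -> forall e, vanishes_on (pihomog mdeg e f) Z.
Proof.
move=> fZ e q Zq v vq; apply: pihomog_vanish => t.
rewrite -[RHS](fZ q Zq (t *: v)) ?memvZ //; apply: meval_eq => i.
by rewrite mxE.
Qed.

Lemma vanishes_of_pihomog f Z :
  (forall e, vanishes_on (pihomog mdeg e f) Z) -> vanishes_on f Z.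
Proof.
move=> fZ q Zq v vq; rewrite (pihomog_partitionE (leqnn (msize f))) raddf_sum /=.
by apply: big1 => d _; apply: fZ vq.
Qed.

(** Closed sets are defined by forms, so [f] is replaced by its homogeneous components. *)
Lemma poly_locus_closed f : zariski_closed [set q | vanishes_on f [set q]].
Proof.
exists [set pihomog mdeg e f | e in setT].
  by move=> _ [e _ <-]; exists e; apply: pihomogP.
apply/seteqP; split=> q.
  by move=> fq _ [e _ <-] v vq; apply: (vanishes_pihomog fq).
move=> fq; apply: vanishes_of_pihomog => e _ -> v vq.
by apply: (fq _ _ v vq); exists e.
Qed.

Lemma irreducible_prime Z f g : zariski_irreducible Z ->
  vanishes_on (f * g) Z -> vanishes_on f Z \/ vanishes_on g Z.
Proof.
move=> [_ irrZ] fgZ.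
have [|H|H] := irrZ _ _ (poly_locus_closed f) (poly_locus_closed g).
- move=> q Zq.
  have [|H|H] := @line_prime f g q.
  + by move=> v vq; rewrite -mevalM (fgZ q).
  + by left => _ -> v vq; apply: H.
  + by right => _ -> v vq; apply: H.
- by left => q Zq v vq; apply: (H q Zq q).
- by right => q Zq v vq; apply: (H q Zq q).
Qed.

(* Each step of the chain provides a form vanishing on Z_i but not on Z_(i+1); a relation
   among the forms of minimal degree is, modulo the last form, a relation on the smaller set. *)
Lemma chain_alg_indep X s Z : closed_chain X s Z ->
  exists f : nat -> {mpoly K[N.+1]}, forall G : {mpoly K[s.+1]},
    (forall q, Z s q -> forall v, v \in val q ->
       G.@[fun i => (f i).@[v 0]] = 0) -> G = 0.
Proof.
elim: s => [|s IHs] [ch1 ch2].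
  have [_ [[q Zq] _] _] := ch1 0%N (leqnn _).
  have [w w0 qE] := pspaceP q.
  have [j wj] : exists j, w 0 j != 0.
    apply/existsP; apply: contraNT w0; rewrite negb_exists => /forallP w0.
    by apply/eqP/rowP => j; rewrite mxE; apply/eqP/negPn/w0.
  (* A coordinate that is nonzero at [w] takes every value on the line through [w]. *)
  exists (fun=> 'X_j) => G G0; apply: mpoly_vanish => v.
  rewrite -[RHS](G0 q Zq ((v ord0 / w 0 j) *: w)).
    by apply: meval_eq => i; rewrite mevalXU mxE divfK // ord1.
  by rewrite qE memvZ // memv_line.
have [|f fP] := IHs.
  by split=> i si; [apply: ch1; apply: leqW | apply: ch2; apply: leqW].
have [[F Fhom ZsE] _ _] := ch1 s (leqnSn s).
have [clS irrS _] := ch1 s.+1 (leqnn _).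
have [_ /existsNP[q /not_implyP[Zq Zsq]]] := ch2 s (ltnSn s).
have [g Fg [w wq gw]] : exists2 g, F g & exists2 w, w \in val q & g.@[w 0] != 0.
  apply: contrapT => nog; apply: Zsq; rewrite ZsE => g Fg w wq.
  apply/eqP/negPn/negP => gw; apply: nog; exists g => //; by exists w.
pose f' i := if (i < s.+1)%N then f i else g.
exists f' => G; have [k] := ubnP (msize G); elim: k G => // k IHk G szG G0.
have [->//|nzG] := eqVneq G 0.
have [H [G1 GE]] := mpoly_split_max G.
(* On [Z s] the form [g] vanishes, so [G1] is a relation there among the earlier functions. *)
have G10 : G1 = 0.
  apply: fP => q' Zq' v vq'.
  have Zq's : Z s.+1 q' by have [H1 _] := ch2 s (ltnSn s); apply: H1.
  have := G0 q' Zq's v vq'.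
  rewrite GE mevalD mevalM mevalXU {1}/f' ltnn meval_mwiden.
  move: (Zq'); rewrite ZsE => /(_ g Fg v vq') ->; rewrite mul0r add0r => E.
  by rewrite -[RHS]E; apply: meval_eq => i; rewrite /f' /= ltn_ord.
rewrite G10 mwiden0 addr0 in GE.
have nzH : H != 0 by apply: contraNneq nzG => H0; rewrite GE H0 mulr0.
rewrite GE (IHk H) ?mulr0 //.
  by rewrite -ltnS (leq_trans _ szG) // GE msize_mulX.
pose HH := H \mPo [tuple f' i | i < s.+2].
have HHE (v : 'rV[K]_N.+1) : HH.@[v 0] = H.@[fun i => (f' i).@[v 0]].
  by rewrite comp_mpoly_meval; apply: meval_eq => i; rewrite tnth_mktuple.
(* The ideal of [Z s.+1] is prime and does not contain [g], so [H] gives again a relation. *)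
have [|gZ|HZ] := @irreducible_prime (Z s.+1) g HH irrS.
- move=> q' Zq' v vq'; have := G0 q' Zq' v vq'.
  by rewrite GE !mevalM mevalXU {1}/f' ltnn HHE.
- by case/eqP: gw; apply: gZ wq.
- by move=> q' Zq' v vq'; rewrite -HHE; apply: HZ vq'.
Qed.
End Loci.

(** * Polynomial maps and the closures of their images *)

Section PolyMaps.
Variables (K : numFieldType) (N : nat).
Implicit Types (f g : {mpoly K[N.+1]}) (v w : 'rV[K]_N.+1) (q : pspace K N).

Definition poly_map m (phi : N.+1.-tuple {mpoly K[m]}) (x : 'rV[K]_m) : 'rV[K]_N.+1 :=
  \row_j (tnth phi j).@[x 0].

Lemma poly_mapE m (phi : N.+1.-tuple {mpoly K[m]}) (x : 'rV[K]_m) j :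
  poly_map phi x 0 j = (tnth phi j).@[x 0].
Proof. by rewrite mxE. Qed.

Lemma meval_poly_map m (phi : N.+1.-tuple {mpoly K[m]}) f (x : 'rV[K]_m) :
  (f \mPo phi).@[x 0] = f.@[poly_map phi x 0].
Proof. by rewrite comp_mpoly_meval; apply: meval_eq => i; rewrite mxE. Qed.

Lemma mpoly_vanish_row m (p : {mpoly K[m]}) :
  (forall x : 'rV[K]_m, p.@[x 0] = 0) -> p = 0.
Proof.
move=> p0; apply: mpoly_vanish => v; rewrite -[RHS](p0 (\row_i v i)).
by apply: meval_eq => i; rewrite mxE.
Qed.

(** Scaling in the target comes from scaling the parameters; hence the homogeneous components of a
    polynomial vanishing on the image vanish there too. *)
Definition cone_map m (phi : N.+1.-tuple {mpoly K[m]}) :=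
  forall t, exists c, forall x, poly_map phi (c *: x) = t *: poly_map phi x.

Lemma poly_map_pihomog m (phi : N.+1.-tuple {mpoly K[m]}) H : cone_map phi ->
  (forall x, H.@[poly_map phi x 0] = 0) ->
  forall e x, (pihomog mdeg e H).@[poly_map phi x 0] = 0.
Proof.
move=> cphi H0 e x; apply: pihomog_vanish => t.
have [c cE] := cphi t; rewrite -[RHS](H0 (c *: x)) cE.
by apply: meval_eq => i; rewrite !mxE.
Qed.

(** If [m <= s], the [s + 1] functions independent on [Z s] become dependent after composition with
    [phi]. The relation vanishes on the image, hence on [X], a contradiction. *)
Lemma chain_upper m (phi : N.+1.-tuple {mpoly K[m]}) (X : set (pspace K N)) s Z :
  cone_map phi ->
  (forall e f, f \is e.-homog -> (forall x, f.@[poly_map phi x 0] = 0) -> vanishes_on f X) ->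
  closed_chain X s Z -> (s < m)%N.
Proof.
move=> cphi Xphi chZ; have [f fP] := chain_alg_indep chZ.
have [_ _ ZX] := chZ.1 s (leqnn _).
rewrite ltnNge; apply/negP => ms.
have [G nzG G0] := @mpoly_dependent _ m s.+1 [tuple f i \mPo phi | i < s.+1] ms.
pose H := G \mPo [tuple f i | i < s.+1].
have HE v : H.@[v 0] = G.@[fun i => (f i).@[v 0]].
  by rewrite comp_mpoly_meval; apply: meval_eq => i; rewrite tnth_mktuple.
have H0 x : H.@[poly_map phi x 0] = 0.
  rewrite HE -[RHS](meval0 (x 0)) -G0 comp_mpoly_meval; apply: meval_eq => i.
  by rewrite tnth_mktuple meval_poly_map.
case/eqP: nzG; apply: fP => q Zq v vq; rewrite -HE.
have : vanishes_on H X.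
  apply: vanishes_of_pihomog => e; apply: Xphi (pihomogP _ _ _) _.
  exact: poly_map_pihomog.
by move=> /(_ q (ZX q Zq)); apply.
Qed.

Definition jac m (phi : N.+1.-tuple {mpoly K[m]}) (x : 'rV[K]_m) : 'M[K]_(m, N.+1) :=
  \matrix_(l, j) ((tnth phi j)^`M(l)).@[x 0].

(** The restriction of [phi] to the row space of [L]. *)
Definition lin_comp m n (phi : N.+1.-tuple {mpoly K[m]}) (L : 'M[K]_(n, m)) :
    N.+1.-tuple {mpoly K[n]} :=
  [tuple tnth phi j \mPo [tuple \sum_a L a l *: 'X_a | l < m] | j < N.+1].

Lemma poly_map_lin_comp m n (phi : N.+1.-tuple {mpoly K[m]}) (L : 'M[K]_(n, m)) y :
  poly_map (lin_comp phi L) y = poly_map phi (y *m L).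
Proof.
apply/rowP => j; rewrite !mxE tnth_mktuple comp_mpoly_meval; apply: meval_eq => l.
rewrite tnth_mktuple mxE raddf_sum /=; apply: eq_bigr => a _.
by rewrite mevalZ mevalXU mulrC.
Qed.

Lemma jac_lin_comp m n (phi : N.+1.-tuple {mpoly K[m]}) (L : 'M[K]_(n, m)) y :
  jac (lin_comp phi L) y = L *m jac phi (y *m L).
Proof.
apply/matrixP => a j; rewrite !mxE tnth_mktuple mderiv_comp raddf_sum /=.
apply: eq_bigr => l _; rewrite mevalM tnth_mktuple !mxE mulrC; congr (_ * _).
  rewrite (raddf_sum (mderiv a)) raddf_sum /= (bigD1 a) //= big1 => [|b ba].
    by rewrite mderivZ mderivX mnm1E eqxx scale1r -{1}[U_(a)%MM]add0m addmK mpolyX0 mevalZ meval1 mulr1 addr0.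
  by rewrite mderivZ mderivX mnm1E (negPf ba) scale0r scaler0 meval0.
rewrite comp_mpoly_meval; apply: meval_eq => i.
rewrite tnth_mktuple mxE raddf_sum /=; apply: eq_bigr => b _.
by rewrite mevalZ mevalXU mulrC.
Qed.

(** Euler's identity for forms, checked monomial by monomial. *)
Lemma euler m (f : {mpoly K[m]}) d (p : 'I_m -> K) : f \is d.-homog ->
  \sum_l p l * (f^`M(l)).@[p] = d%:R * f.@[p].
Proof.
move=> /dhomogP fd; transitivity (\sum_l ('X_l * f^`M(l))).@[p].
  by rewrite raddf_sum /=; apply: eq_bigr => l _; rewrite mevalM mevalXU.
rewrite -mevalZ; congr _.@[_]; rewrite [in LHS](mpolyE f) [in RHS](mpolyE f).
under eq_bigr => l _ do rewrite (raddf_sum (mderiv l)) mulr_sumr /=.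
rewrite exchange_big /= scaler_sumr big_seq [RHS]big_seq; apply: eq_bigr => mm /fd <-.
rewrite /= mdegE natr_sum scaler_suml; apply: eq_bigr => l _.
rewrite mderivZ mderivX -!scalerAr [RHS]scalerA [X in _ = X *: _]mulrC -[RHS]scalerA; congr (_ *: _).
case: (posnP (mm l)) => [->|m0]; first by rewrite !scale0r.
by rewrite -mpolyXD addmC submK // lep1mP -lt0n.
Qed.

Section Locus.
Variables (m : nat) (phi : N.+1.-tuple {mpoly K[m]}).

(** The closure of the projective image under [phi] of the row space of [L]. *)
Definition image_locus n (L : 'M[K]_(n, m)) : set (pspace K N) :=
  zero_locus [set f | (exists e, f \is e.-homog) /\ forall y, f.@[poly_map phi (y *m L) 0] = 0].

Lemma image_locus_closed n (L : 'M[K]_(n, m)) : zariski_closed (image_locus L).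
Proof.
by exists [set f | (exists e, f \is e.-homog) /\ forall y, f.@[poly_map phi (y *m L) 0] = 0] => // f [].
Qed.

Lemma image_locus_pt n (L : 'M[K]_(n, m)) y (nz : poly_map phi (y *m L) != 0) :
  image_locus L (pt nz).
Proof.
move=> f [[e fe] f0] v /vlineP[t ->].
rewrite (meval_eq (v2 := fun i => t * poly_map phi (y *m L) 0 i)) => [|i]; last by rewrite mxE.
by rewrite (meval_homog _ _ fe) f0 mulr0.
Qed.

Lemma not_sub_zero_locus (Z : set (pspace K N)) (F : set {mpoly K[N.+1]}) :
  ~ Z `<=` zero_locus F -> exists q f, [/\ Z q, F f & exists2 v, v \in val q & f.@[v 0] != 0].
Proof.
move=> /existsNP[q /not_implyP[Zq Fq]].
apply: contrapT => nof; apply: Fq => f Ff v vq; apply/eqP/negPn/negP => fv.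
by apply: nof; exists q, f; split => //; exists v.
Qed.

Lemma image_locus_nonzero n (L : 'M[K]_(n, m)) q f e v : image_locus L q ->
  f \is e.-homog -> v \in val q -> f.@[v 0] != 0 -> f \mPo lin_comp phi L != 0.
Proof.
move=> Lq fe vq; apply: contraNneq => f0; apply/eqP/(Lq f _ v vq); split; first by exists e.
by move=> y; rewrite -poly_map_lin_comp -meval_poly_map f0 meval0.
Qed.

Lemma poly_map_coord_neq0 n (L : 'M[K]_(n, m)) y : poly_map phi (y *m L) != 0 ->
  exists j, tnth (lin_comp phi L) j != 0.
Proof.
move=> nz; apply/existsP; apply: contraNT nz; rewrite negb_exists => /forallP H.
apply/eqP/rowP => j; rewrite -poly_map_lin_comp !mxE.
by have /negPn/eqP -> := H j; rewrite meval0.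
Qed.

(** If neither closed set contains the locus, there are forms [f] and [f'] whose pullbacks are
    nonzero polynomials with vanishing product. *)
Lemma image_locus_irreducible n (L : 'M[K]_(n, m)) y0 :
  poly_map phi (y0 *m L) != 0 -> zariski_irreducible (image_locus L).
Proof.
move=> nz; split; first by exists (pt nz); apply: image_locus_pt.
move=> A B [F Fh ->] [F' Fh' ->] AB.
apply: contrapT => /not_orP[].
move=> /not_sub_zero_locus[q [f [Lq /[dup] Ff /Fh [e fe] [v vq fv]]]].
move=> /not_sub_zero_locus[q' [f' [Lq' /[dup] Ff' /Fh' [e' fe'] [v' vq' fv']]]].
have nf := image_locus_nonzero Lq fe vq fv.
have nf' := image_locus_nonzero Lq' fe' vq' fv'.
have [j nj] := poly_map_coord_neq0 nz.
(* The coordinate factor takes care of the parameters sent to 0, which define no projective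
   point. *)
suff : (f \mPo lin_comp phi L) * (f' \mPo lin_comp phi L) * tnth (lin_comp phi L) j = 0.
  by move/eqP; rewrite !mulf_eq0 (negPf nf) (negPf nf') (negPf nj).
apply: mpoly_vanish_row => y; rewrite !mevalM !meval_poly_map.
have [y0E|ny] := eqVneq (poly_map phi (y *m L)) 0.
  have -> : (tnth (lin_comp phi L) j).@[y 0] = 0 by rewrite -poly_mapE poly_map_lin_comp y0E mxE.
  by rewrite mulr0.
have mem : poly_map (lin_comp phi L) y \in val (pt ny) by rewrite poly_map_lin_comp memv_line.
case: (AB _ (@image_locus_pt _ L y ny)) => [/(_ f Ff _ mem)|/(_ f' Ff' _ mem)] ->.
  by rewrite !mul0r.
by rewrite mulr0 mul0r.
Qed.

Lemma image_locus_sub n (L : 'M[K]_(n, m)) y0 (X : set (pspace K N)) :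
  poly_map phi (y0 *m L) != 0 -> zariski_closed X ->
  (forall x (nz : poly_map phi x != 0), X (pt nz)) -> image_locus L `<=` X.
Proof.
move=> nz [F Fh ->] XF; apply: contrapT.
move=> /not_sub_zero_locus[q [f [Lq /[dup] Ff /Fh [e fe] [v vq fv]]]].
have nf := image_locus_nonzero Lq fe vq fv.
have [j nj] := poly_map_coord_neq0 nz.
suff : (f \mPo lin_comp phi L) * tnth (lin_comp phi L) j = 0.
  by move/eqP; rewrite !mulf_eq0 (negPf nf) (negPf nj).
apply: mpoly_vanish_row => y; rewrite !mevalM !meval_poly_map.
have [y0E|ny] := eqVneq (poly_map phi (y *m L)) 0.
  have -> : (tnth (lin_comp phi L) j).@[y 0] = 0 by rewrite -poly_mapE poly_map_lin_comp y0E mxE.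
  by rewrite mulr0.
have mem : poly_map (lin_comp phi L) y \in val (pt ny) by rewrite poly_map_lin_comp memv_line.
by rewrite (XF _ ny f Ff _ mem) mul0r.
Qed.
End Locus.
End PolyMaps.

(** * Long chains from the rank of the Jacobian matrix *)

Section Lower.
Variables (K : numFieldType) (N m : nat) (phi : N.+1.-tuple {mpoly K[m]}).

Definition flag (R : nat -> 'rV[K]_m) i : 'M[K]_(i.+1, m) := \matrix_(a < i.+1) R a.

Lemma flag_row0 R i : delta_mx 0 0 *m flag R i = R 0%N.
Proof. by rewrite -rowE rowK. Qed.

Lemma flag_sub R i (y : 'rV_i.+1) : exists y' : 'rV_i.+2, y' *m flag R i.+1 = y *m flag R i.
Proof.
exists (\row_a if unlift ord_max a is Some b then y 0 b else 0).
rewrite !mulmx_sum_row big_ord_recr /= mxE unlift_none scale0r addr0.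
apply: eq_bigr => a _; rewrite !rowK mxE.
by rewrite (_ : widen_ord _ a = lift ord_max a) ?liftK //;
  apply/val_inj; rewrite /= /bump leqNgt ltn_ord.
Qed.

(* On the smaller linear space too few parameters are left for the i+2 linear combinations
   of the coordinates given by Q to be independent; on the larger one the Jacobian criterion
   makes them independent. *)
Lemma image_locus_strict R i (Q : 'M[K]_(N.+1, i.+2)) : cone_map phi ->
  poly_map phi (R 0%N) != 0 ->
  flag R i.+1 *m jac phi (R 0%N) *m Q = 1%:M ->
  image_locus phi (flag R i) `<` image_locus phi (flag R i.+1).
Proof.
move=> cphi nz JQ; split.
  move=> q Lq f [fh f0]; apply: Lq; split => // y.
  by have [y' <-] := flag_sub R y; apply: f0.
move=> sub.
pose psi j : i.+2.-tuple {mpoly K[j.+1]} :=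
  [tuple \sum_l Q l b *: tnth (lin_comp phi (flag R j)) l | b < i.+2].
have [G nzG G0] := mpoly_dependent (psi i) (ltnSn _).
pose H := G \mPo [tuple \sum_l Q l b *: 'X_l | b < i.+2].
have HE j y : H.@[poly_map phi (y *m flag R j) 0] = (G \mPo psi j).@[y 0].
  rewrite !comp_mpoly_meval; apply: meval_eq => b; rewrite !tnth_mktuple !raddf_sum /=.
  by apply: eq_bigr => l _; rewrite !mevalZ mevalXU -poly_map_lin_comp poly_mapE.
have HZ : vanishes_on H (image_locus phi (flag R i)).
  apply: vanishes_of_pihomog => e q Lq v vq; apply: (Lq _ _ v vq); split.
    by exists e; apply: pihomogP.
  move=> y; rewrite -poly_map_lin_comp; apply: poly_map_pihomog => [t|x].
    have [c cE] := cphi t; exists c => x.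
    by rewrite !poly_map_lin_comp -scalemxAl cE.
  by rewrite poly_map_lin_comp HE G0 meval0.
case/eqP: nzG; apply: (@jacobian_criterion _ _ (psi i.+1) ((delta_mx 0 0 : 'rV_i.+2) 0)).
  rewrite (_ : \matrix_(_, _) _ = jac (lin_comp phi (flag R i.+1)) (delta_mx 0 0) *m Q).
    by rewrite jac_lin_comp flag_row0 JQ det1 oner_neq0.
  apply/matrixP => a b; rewrite !mxE tnth_mktuple (raddf_sum (mderiv a)) raddf_sum /=.
  by apply: eq_bigr => l _; rewrite mderivZ mevalZ mxE mulrC.
apply: mpoly_vanish_row => y; rewrite -HE.
(* If [y] is sent to 0, the value of [H] is that at the zero vector, which lies on every line of the
   smaller locus. *)
have [->|ny] := eqVneq (poly_map phi (y *m flag R i.+1)) 0.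
  have Ri : poly_map phi (delta_mx 0 0 *m flag R i) != 0 by rewrite flag_row0.
  exact: (HZ _ (@image_locus_pt _ _ _ phi _ _ _ Ri) 0 (mem0v _)).
by apply: (HZ (pt ny)); [exact/sub/image_locus_pt | apply: memv_line].
Qed.

Lemma euler_jac d (p : 'rV[K]_m) : (forall j, tnth phi j \is d.-homog) ->
  p *m jac phi p = d%:R *: poly_map phi p.
Proof.
move=> hphi; apply/rowP => j; rewrite !mxE -(euler _ (hphi j)).
by apply: eq_bigr => l _; rewrite !mxE.
Qed.

(** A minor and a coordinate of [phi] are nonzero polynomials, so their product is nonzero at some
    point. *)
Lemma jac_rank_generic (p : 'rV[K]_m) r : (0 < r)%N -> (r <= \rank (jac phi p))%N ->
  exists2 p', (r <= \rank (jac phi p'))%N & poly_map phi p' != 0.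
Proof.
move=> r0 rk; set J := jac phi p in rk.
have [P [Q PJQ]] := mxrank_ge_id rk.
pose PP : 'M[{mpoly K[m]}]_(r, m) := map_mx (@mpolyC m K) P.
pose QQ : 'M[{mpoly K[m]}]_(N.+1, r) := map_mx (@mpolyC m K) Q.
pose JJ : 'M[{mpoly K[m]}]_(m, N.+1) := \matrix_(l, j) (tnth phi j)^`M(l).
have ev (x : 'rV[K]_m) : (\det (PP *m JJ *m QQ)).@[x 0] = \det (P *m jac phi x *m Q).
  rewrite -det_map_mx !map_mxM; congr (\det (_ *m _ *m _)).
  - by apply/matrixP => a b; rewrite !mxE /= mevalC.
  - by apply/matrixP => a b; rewrite !mxE.
  - by apply/matrixP => a b; rewrite !mxE /= mevalC.
have nzD : \det (PP *m JJ *m QQ) != 0.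
  apply/eqP => D0; have := ev p; rewrite D0 meval0 PJQ det1.
  by move/eqP; rewrite eq_sym oner_eq0.
have [j nj] : exists j, tnth phi j != 0.
  apply/existsP; apply: contraTT rk; rewrite negb_exists => /forallP H.
  rewrite (_ : J = 0) ?mxrank0 -?ltnNge //.
  by apply/matrixP => l j; have /negPn/eqP := H j; rewrite !mxE => ->; rewrite mderiv0 meval0.
have [p' np'] : exists p' : 'rV[K]_m, (\det (PP *m JJ *m QQ) * tnth phi j).@[p' 0] != 0.
  apply: contrapT => H; suff : \det (PP *m JJ *m QQ) * tnth phi j = 0.
    by move/eqP; rewrite mulf_eq0 (negPf nzD) (negPf nj).
  by apply: mpoly_vanish_row => x; apply/eqP/negPn/negP => nx; apply: H; exists x.
move: np'; rewrite mevalM mulf_eq0 negb_or ev => /andP[np1 np2].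
exists p'; last by apply: contraNneq np2 => p0; rewrite -poly_mapE p0 mxE.
have : (P *m jac phi p' *m Q) \in unitmx by rewrite unitmxE unitfE.
move=> /mxrank_unit <-; apply: leq_trans (mxrankM_maxl _ _) _.
exact: mxrankM_maxr.
Qed.

Lemma chain_lower d (p : 'rV[K]_m) r (X : set (pspace K N)) : (0 < d)%N ->
  (forall j, tnth phi j \is d.-homog) -> cone_map phi -> zariski_closed X ->
  (forall x (nz : poly_map phi x != 0), X (pt nz)) -> (r < \rank (jac phi p))%N ->
  exists Z, closed_chain X r Z.
Proof.
move=> d0 hphi cphi clX Xphi.
move=> /(jac_rank_generic (ltn0Sn r))[{}p]; set J := jac phi p => rk nz.
have u0 : p *m J != 0 by rewrite (euler_jac _ hphi) scaler_eq0 negb_or pnatr_eq0 -lt0n d0.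
set u := p *m J in u0.
(* By Euler's identity [u] is a nonzero multiple of the image of [p], so [p] can start the flag; a
   complement of [u] in the row space of [J] supplies the other directions. *)
pose C := row_base (J :\: u)%MS.
have CJ : (C <= J)%MS by rewrite eq_row_base diffmxSl.
have [P CE] := submxP CJ.
have uJ : (u <= J)%MS by rewrite submxMl.
have rkM : \rank (col_mx u C) = \rank J.
  rewrite -addsmxE (adds_eqmx (eqmx_refl u) (eq_row_base _)) addsmxC.
  by rewrite -(adds_eqmx (eqmx_refl _) (capmx_idPr uJ)) addsmx_diff_cap_eq.
have rkJ : (1 + \rank (J :\: u)%MS = \rank J)%N.
  by rewrite -(mxrank_cap_compl J u) (capmx_idPr uJ) rank_rV u0.
have /row_freeP[Q MQ] : row_free (col_mx u C) by rewrite /row_free rkM rkJ.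
(* The vectors [R a] are sent by [J] to the rows of the free matrix [col_mx u C]; the default 0 is
   taken only beyond its last row. *)
pose R a := if a is b.+1 then oapp (fun o => row o P) 0 (insub b) else p.
have RJ i : (i <= r)%N -> exists Q', flag R i *m J *m Q' = 1%:M.
  move=> ir.
  have ile (a : 'I_i.+1) : (a < 1 + \rank (J :\: u)%MS)%N.
    by rewrite rkJ (leq_trans (ltn_ord a)) // (leq_trans _ rk).
  pose h a := Ordinal (ile a).
  exists (Q *m colsub h 1%:M).
  have -> : flag R i *m J = rowsub h (col_mx u C).
    apply/row_matrixP => a; rewrite row_mul rowK row_rowsub.
    case: (splitP (h a)) => [o|o] ho.
      have -> : h a = lshift _ o by apply/val_inj.
      rewrite rowKu (_ : R a = p) ?row_id ?ord1 ?row_id //.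
      by move: ho; rewrite ord1 /= => ->.
    have -> : h a = rshift _ o by apply/val_inj.
    rewrite rowKd CE row_mul; congr (_ *m _).
    by move: ho; rewrite /= add1n => ->; rewrite /R /= valK.
  rewrite mulmxA mul_rowsub_mx MQ -rowsubE; apply/matrixP => a b.
  by rewrite !mxE.
exists (fun i => image_locus phi (flag R i)); split=> i ir.
  have nzi : poly_map phi (delta_mx 0 0 *m flag R i) != 0 by rewrite flag_row0.
  split; [exact: image_locus_closed | exact: image_locus_irreducible nzi |].
  exact: image_locus_sub nzi clX Xphi.
have [Q' Q'E] := RJ i.+1 ir.
exact: image_locus_strict Q'E.
Qed.

End Lower.

(** * Secant varieties of Veronese varieties *)

Section Monomials.
Variables (n d : nat).

Definition mon (l : 'I_('C(d + n, n).-1).+1) : 'X_{1..n.+1} := nth 0%MM (monomials n.+1 d) l.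

Lemma mdeg_mon l : mdeg (mon l) = d.
Proof. by apply/eqP; rewrite basis_cover mem_nth // size_monomials. Qed.

Lemma mon_inj : injective mon.
Proof.
move=> l l' /eqP; rewrite nth_uniq ?size_monomials ?uniq_basis // => /eqP.
exact: val_inj.
Qed.

Lemma mon_surj m : mdeg m = d -> exists l, mon l = m.
Proof.
move/eqP; rewrite basis_cover => mm.
have lm : (index m (monomials n.+1 d) < ('C(d + n, n).-1).+1)%N.
  by rewrite -size_monomials index_mem.
by exists (Ordinal lm); rewrite /mon nth_index.
Qed.
End Monomials.

Section Veronese.
Variables (K : numClosedFieldType) (n d : nat).
Hypothesis d_gt0 : (0 < d)%N.
Local Notation N := ('C(d + n, n).-1).
Implicit Types (v : 'rV[K]_n.+1) (k : nat).

Lemma veronese_vecE v l : veronese_vec d v 0 l = \prod_j v 0 j ^+ mon l j.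
Proof. by rewrite mxE. Qed.

Lemma veronese_vecZ t v : veronese_vec d (t *: v) = t ^+ d *: veronese_vec d v.
Proof.
apply/rowP => l; rewrite [RHS]mxE !veronese_vecE -[X in t ^+ X](mdeg_mon l) mdegE -prodrXr -big_split /=.
by apply: eq_bigr => j _; rewrite mxE exprMn.
Qed.

Lemma veronese_vec_neq0 v : v != 0 -> veronese_vec d v != 0.
Proof.
move=> v0; have [j vj] : exists j, v 0 j != 0.
  apply/existsP; apply: contraNT v0; rewrite negb_exists => /forallP v0.
  by apply/eqP/rowP => j; rewrite mxE; apply/eqP/negPn/v0.
have [l lE] := @mon_surj n d (U_(j) *+ d) ltac:(by rewrite mdegMn mdeg1 mul1n).
apply/eqP => /rowP/(_ l); rewrite veronese_vecE lE mxE (bigD1 j) //= big1 => [|i ij].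
  by rewrite mulmnE mnm1E eqxx mul1n mulr1 => /eqP; rewrite expf_eq0 (negPf vj) andbF.
by rewrite mulmnE mnm1E eq_sym (negPf ij) mul0n expr0.
Qed.

Lemma veronese_vec0 : veronese_vec d (0 : 'rV[K]_n.+1) = 0.
Proof. by rewrite -[0 in LHS](scale0r 0) veronese_vecZ expr0n eqn0Ngt d_gt0 scale0r. Qed.

(** The map [x - projv U x] kills all Veronese vectors. Each of its coordinates, evaluated there, is
    a polynomial in [v] whose coefficients are its values at the basis vectors, so these are
    zero. *)
Lemma veronese_nondegenerate (U : {vspace 'rV[K]_N.+1}) :
  (forall v, veronese_vec d v \in U) -> U = fullv.
Proof.
move=> vU; apply/eqP; rewrite eqEsubv subvf /=; apply/subvP => y _.
pose g x := x - projv U x.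
have gE x b : g x 0 b = \sum_a x 0 a * g (delta_mx 0 a) 0 b.
  have -> : g x = \sum_a x 0 a *: g (delta_mx 0 a).
    rewrite /g {1 2}(row_sum_delta x) linear_sum -sumrB; apply: eq_bigr => a _.
    by rewrite linearZ scalerBr.
  by rewrite summxE; apply: eq_bigr => a _; rewrite mxE.
have g0 a b : g (delta_mx 0 a) 0 b = 0.
  pose P : {mpoly K[n.+1]} := \sum_a g (delta_mx 0 a) 0 b *: 'X_[mon a].
  have P0 : P = 0.
    apply: mpoly_vanish_row => v; rewrite raddf_sum /=.
    transitivity (g (veronese_vec d v) 0 b); last by rewrite /g projv_id // subrr mxE.
    by rewrite gE; apply: eq_bigr => c _; rewrite mevalZ mevalX veronese_vecE mulrC.
  transitivity (P@_(mon a)); last by rewrite P0 mcoeff0.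
  rewrite raddf_sum /= (bigD1 a) //= mcoeffZ mcoeffX eqxx mulr1 big1 ?addr0 // => c ca.
  by rewrite mcoeffZ mcoeffX (inj_eq (@mon_inj n d)) (negPf ca) mulr0.
suff -> : y = projv U y by apply: memv_proj.
apply/eqP; rewrite -subr_eq0 -/(g y); apply/eqP/rowP => b.
by rewrite gE mxE big1 // => a _; rewrite g0 mulr0.
Qed.

Definition vpt v (v0 : v != 0) : pspace K N := pt (veronese_vec_neq0 v0).

Lemma Veronese_vpt v (v0 : v != 0) : Veronese K n d (vpt v0).
Proof. by exists v. Qed.

Definition on_cone (y : 'rV[K]_N.+1) := exists v, y = veronese_vec d v.

Lemma free_reduction (s : seq 'rV[K]_N.+1) : (forall y, y \in s -> on_cone y) ->
  exists s', [/\ free s', forall y, y \in s' -> on_cone y, (size s' <= size s)%N &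
    (<<s>> <= <<s'>>)%VS].
Proof.
elim: s => [|y s IH] sc; first by exists [::]; rewrite nil_free.
have [|s' [fs' cs' ss' sub]] := IH; first by move=> z zs; apply: sc; rewrite inE zs orbT.
have [ys'|ys'] := boolP (y \in <<s'>>%VS).
  exists s'; split=> //; first exact: leqW.
  by rewrite span_cons subv_add -memvE ys' sub.
exists (y :: s'); split=> //; first by rewrite free_cons ys'.
- by move=> z; rewrite inE => /orP[/eqP ->|/cs' //]; apply: sc; rewrite mem_head.
- by rewrite !span_cons addvS.
Qed.

Lemma free_extension m (s : seq 'rV[K]_N.+1) : free s -> (forall y, y \in s -> on_cone y) ->
  (size s <= m)%N -> (m <= N.+1)%N ->
  exists s', [/\ free s', forall y, y \in s' -> on_cone y, size s' = m &
    (<<s>> <= <<s'>>)%VS].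
Proof.
move=> fs cs sm mN; elim: m sm mN => [|m IH] sm mN.
  by exists s; split => //; apply/eqP; rewrite -leqn0.
move: sm; rewrite leq_eqVlt => /orP[/eqP sm|sm]; first by exists s.
have [//||s' [fs' cs' ss' sub]] := IH; first exact: ltnW.
have [v vs'] : exists v, veronese_vec d v \notin <<s'>>%VS.
  apply: contrapT => H; have E : <<s'>>%VS = fullv.
    apply: veronese_nondegenerate => v; apply/negPn/negP => vs'; apply: H; by exists v.
  move: fs'; rewrite /free E dimvf ss' /= => /eqP E'.
  by move: mN; rewrite -E' /dim /= mul1n ltnn.
exists (veronese_vec d v :: s'); split=> /=.
- by rewrite free_cons vs'.
- by move=> z; rewrite inE => /orP[/eqP ->|/cs' //]; exists v.
- by rewrite ss'.
- by rewrite (subv_trans sub) // span_cons addvSr.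
Qed.

(** The given vectors may be dependent or zero. They are reduced to a free family, then extended to
    [k + 1] independent Veronese vectors, which exist because such vectors span the space and
    [k <= N]. *)
Lemma sum_veronese_Sec k (w : 'I_k.+1 -> 'rV[K]_n.+1) (nz : \sum_i veronese_vec d (w i) != 0) :
  (k <= N)%N -> Sec k (Veronese K n d) (pt nz).
Proof.
move=> kN; rewrite /Sec kN; apply: sub_gen_smallest.
have [|s1 [f1 c1 z1 sub1]] := @free_reduction [seq veronese_vec d (w i) | i <- enum 'I_k.+1].
  by move=> _ /mapP[i _ ->]; exists (w i).
have [||s [fs cs zs sub]] := @free_extension k.+1 s1 f1 c1.
- by rewrite (leq_trans z1) // size_map size_enum_ord.
- by [].
have [u uE] : exists u : 'I_k.+1 -> 'rV[K]_n.+1, forall i : 'I_k.+1, s`_i = veronese_vec d (u i).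
  suff /choice[u uE] : forall i : 'I_k.+1, exists u, s`_i = veronese_vec d u by exists u.
  move=> i.
  by apply: cs; rewrite mem_nth // zs.
have u0 i : u i != 0.
  apply/eqP => ui; have : s`_i \in s by rewrite mem_nth ?zs.
  by move=> /(free_not0 fs); rewrite uE ui veronese_vec0 eqxx.
exists (fun i => vpt (u0 i)).
have sumE : (\sum_i val (vpt (u0 i)))%VS = <<s>>%VS.
  rewrite span_def [RHS](big_nth 0) zs big_mkord; apply: eq_bigr => i _.
  by rewrite /= uE.
split; first by move=> i; apply: Veronese_vpt.
  by rewrite sumE (eqP fs).
rewrite sumE; suff : \sum_i veronese_vec d (w i) \in <<s>>%VS by rewrite memvE.
apply: (subvP (subv_trans sub1 sub)); apply: memv_suml => i _.
by apply: memv_span; apply: map_f; rewrite mem_enum.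
Qed.

(** Over an algebraically closed field a multiple of a Veronese vector is a Veronese vector, so
    every vector in the span of [k + 1] points is a sum as in the hypothesis. *)
Lemma vanishes_Sec k (f : {mpoly K[N.+1]}) : (k <= N)%N ->
  (forall w : 'I_k.+1 -> 'rV[K]_n.+1, f.@[(\sum_i veronese_vec d (w i)) 0] = 0) ->
  vanishes_on f (Sec k (Veronese K n d)).
Proof.
move=> kN f0; rewrite /Sec kN => q Sq.
suff : [set q | vanishes_on f [set q]] q by apply.
apply: Sq; split; first exact: poly_locus_closed.
move=> {}q [p [pV _ qp]] _ -> v vq.
have /memv_sumP[c cp ->] := subvP qp _ vq.
have [w wE] : exists w : 'I_k.+1 -> 'rV[K]_n.+1, forall i, c i = veronese_vec d (w i).
  suff /choice[w wE] : forall i, exists w, c i = veronese_vec d w by exists w.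
  move=> i.
  have [u _ pE] := pV i; have := cp i isT; rewrite pE => /vlineP[t ->].
  by exists (d.-root t *: u); rewrite veronese_vecZ rootCK.
by rewrite (eq_bigr (fun i => veronese_vec d (w i))) // => i _.
Qed.
End Veronese.

(** * The polynomial map parametrizing the secant variety *)

Section SecantMap.
Variables (K : numClosedFieldType) (n d k : nat).
Hypothesis d_gt0 : (0 < d)%N.
Local Notation N := ('C(d + n, n).-1).
Local Notation M := (k.+1 * n.+1)%N.

(* The variable of index [mxvec_index i j] is the j-th coordinate of the i-th point. *)
Definition block_mon (i : 'I_k.+1) (m : 'X_{1..n.+1}) : 'X_{1..M} :=
  (\sum_j U_(mxvec_index i j) *+ m j)%MM.

Definition secant_map : N.+1.-tuple {mpoly K[M]} :=
  [tuple \sum_i 'X_[block_mon i (mon l)] | l < N.+1].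

Lemma block_monE i m i' j : block_mon i m (mxvec_index i' j) = ((i == i') * m j)%N.
Proof.
have idx_eq (i1 i2 : 'I_k.+1) (j1 j2 : 'I_n.+1) :
    (mxvec_index i1 j1 == mxvec_index i2 j2) = ((i1 == i2) && (j1 == j2)).
  apply/eqP/andP => [/cast_ord_inj/enum_rank_inj[-> ->]|[/eqP -> /eqP ->]] //.
rewrite /block_mon mnm_sumE (bigD1 j) //= big1 ?addn0 => [|j' jj'].
  by rewrite mulmnE mnm1E idx_eq eqxx andbT.
by rewrite mulmnE mnm1E idx_eq (negPf jj') andbF mul0n.
Qed.

Lemma meval_block_mon i m (x : 'rV[K]_M) :
  'X_[block_mon i m].@[x 0] = \prod_j vec_mx x i j ^+ m j.
Proof.
rewrite /block_mon -mprodXnE rmorph_prod; apply: eq_bigr => j _ /=.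
by rewrite rmorphXn /= mevalXU mxE.
Qed.

Lemma poly_map_secant x : poly_map secant_map x = \sum_i veronese_vec d (row i (vec_mx x)).
Proof.
apply/rowP => l; rewrite poly_mapE tnth_mktuple raddf_sum summxE; apply: eq_bigr => i _ /=.
by rewrite meval_block_mon veronese_vecE; apply: eq_bigr => j _; rewrite [in RHS]mxE.
Qed.

Lemma mdeg_block_mon i m : mdeg (block_mon i m) = mdeg m.
Proof.
rewrite /block_mon mdeg_sum mdegE; apply: eq_bigr => j _.
by rewrite mdegMn mdeg1 mul1n.
Qed.

Lemma secant_homog l : tnth secant_map l \is d.-homog.
Proof.
rewrite tnth_mktuple; apply: rpred_sum => i _.
by rewrite dhomogX /= mdeg_block_mon mdeg_mon.
Qed.

Lemma secant_cone : cone_map secant_map.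
Proof.
move=> t; exists (d.-root t) => x; rewrite !poly_map_secant scaler_sumr.
apply: eq_bigr => i _; rewrite -[in RHS](rootCK d_gt0 t) -veronese_vecZ; congr veronese_vec.
by apply/rowP => j; rewrite !mxE.
Qed.

Lemma mderiv_log (m : 'X_{1..M}) (x : 'rV[K]_M) l :
  x 0 l * ('X_[m]^`M(l)).@[x 0] = (m l)%:R * 'X_[m].@[x 0].
Proof.
rewrite mderivX mevalZ; have [->|ml] := posnP (m l); first by rewrite !mul0r mulr0.
rewrite mulrCA; congr (_ * _).
by rewrite -{2}(@submK _ U_(l) m) ?lep1mP -?lt0n // mpolyXD mevalM mevalXU mulrC.
Qed.

(** Logarithmic derivatives give the Jacobian matrix the shape of [condmx]. *)
Lemma jac_secant (x : 'rV[K]_M) i j l :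
  x 0 (mxvec_index i j) * jac secant_map x (mxvec_index i j) l =
  (mon l j)%:R * veronese_vec d (row i (vec_mx x)) 0 l.
Proof.
rewrite mxE tnth_mktuple (raddf_sum (mderiv _)) raddf_sum mulr_sumr /=.
rewrite (bigD1 i) //= big1 ?addr0 => [|i' ii']; rewrite mderiv_log block_monE.
  rewrite eqxx mul1n meval_block_mon veronese_vecE; congr (_ * _).
  by apply: eq_bigr => j' _; rewrite [in RHS]mxE.
by rewrite (negPf ii') mul0n mul0r.
Qed.

Lemma chain_Sec_upper s Z : (k <= N)%N ->
  closed_chain (Sec k (Veronese K n d)) s Z -> (s < M)%N.
Proof.
move=> kN; apply: (chain_upper secant_cone) => e f fe f0.
apply: vanishes_Sec => // w; have := f0 (mxvec (\matrix_i w i)).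
rewrite poly_map_secant mxvecK.
suff -> : \sum_i veronese_vec d (row i (\matrix_i w i)) = \sum_i veronese_vec d (w i) by [].
by apply: eq_bigr => i _; rewrite rowK.
Qed.

Lemma Sec_closed : zariski_closed (Sec k (Veronese K n d)).
Proof.
rewrite /Sec; case: ifP => _; first exact: zariski_closure_closed.
by exists set0 => //; apply/seteqP; split=> // q _ f [].
Qed.

Lemma chain_Sec_lower p r : (r < \rank (jac secant_map p))%N ->
  exists Z, closed_chain (Sec k (Veronese K n d)) r Z.
Proof.
apply: (chain_lower d_gt0 secant_homog secant_cone Sec_closed) => x nz.
have [kN|kN] := leqP k N; last by rewrite /Sec leqNgt kN.
have nz' : \sum_i veronese_vec d (row i (vec_mx x)) != 0 by rewrite -poly_map_secant.
have -> : pt nz = pt nz' by apply/val_inj; rewrite /= poly_map_secant.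
exact: sum_veronese_Sec.
Qed.
End SecantMap.

(** The identity map parametrizes the whole projective space. *)
Lemma chain_pspace_upper (K : numFieldType) N (X : set (pspace K N)) s Z :
  closed_chain X s Z -> (s <= N)%N.
Proof.
pose phi : N.+1.-tuple {mpoly K[N.+1]} := [tuple 'X_i | i < N.+1].
have phiE x : poly_map phi x = x by apply/rowP => i; rewrite poly_mapE tnth_mktuple mevalXU.
apply: (@chain_upper _ _ _ phi) => [t|e f fe f0 q _ v _].
  by exists t => x; rewrite !phiE.
by rewrite -[v]phiE.
Qed.

(** * Rank of the Jacobian matrix of the secant map *)

Section Rank.
Variables (K : numFieldType) (n : nat) (e : 'I_n -> Z3).

Lemma conds_cat vs ws : (@conds K n e (vs ++ ws) :=: conds e vs + conds e ws)%MS.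
Proof. by rewrite /conds big_cat. Qed.

Lemma rank_conds vs : (\rank (@conds K n e vs) <= 4 * size vs)%N.
Proof.
rewrite /conds; elim: vs => [|v vs IH]; first by rewrite big_nil mxrank0.
rewrite big_cons mulnS; apply: leq_trans (mxrank_adds_leqif _ _).1 _.
by rewrite leq_add // mxrank_gen rank_leq_row.
Qed.

(** If [4 * k.+1 <= n], points are dropped from [n %/ 4] points of maximal rank; each costs at most
    4, so the rank stays maximal. Otherwise points are added to ceil(n / 4) points that already
    reach rank [n]. *)
Lemma rank_conds_full (A : Z3 -> bool) k : full A n -> (forall x, A x -> exists i, e i = x) ->
  exists vs, [/\ size vs = k.+1, all (@torus K) vs & (minn (4 * k.+1) n <= \rank (conds e vs))%N].
Proof.
move=> [t1 t2] Ae.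
have mask_le (B : 'M[K]_n) r m : (r <= \rank (B *m col_mask K m))%N -> (r <= \rank B)%N.
  by move/leq_trans; apply; apply: mxrankM_maxl.
have [kn|kn] := leqP (4 * k.+1) n.
  have [vs [sz tor /mask_le rk]] := tiled_spans K Ae t1.
  have kq : (k.+1 <= size vs)%N by rewrite sz; lia.
  exists (take k.+1 vs); split.
  - by rewrite size_takel.
  - by move: tor; rewrite -{1}(cat_take_drop k.+1 vs) all_cat => /andP[].
  rewrite -(cat_take_drop k.+1 vs) conds_cat in rk.
  have := leq_trans rk (mxrank_adds_leqif _ _).1.
  have := rank_conds (drop k.+1 vs); rewrite size_drop.
  by move: (\rank _) (\rank _) => a b; lia.
have [vs [sz tor /mask_le rk]] := tiled_spans K Ae t2.
exists (vs ++ nseq (k.+1 - size vs) (1, 1, 1)); split.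
- by rewrite size_cat size_nseq sz; lia.
- by rewrite all_cat tor all_nseq /torus /= !oner_neq0 orbT.
rewrite conds_cat; apply: leq_trans rk _; exact/mxrankS/addsmxSl.
Qed.
End Rank.

Section VeroneseRank.
Variables (K : numClosedFieldType) (d k : nat).
Hypothesis d_ge5 : (5 <= d)%N.
Local Notation N := ('C(d + 3, 3).-1).

(** The exponent of the first variable is determined by the degree; accordingly [homog_pt] has first
    coordinate 1. *)
Definition exponent (l : 'I_N.+1) : Z3 :=
  ((mon l (inord 1))%:Z, (mon l (inord 2))%:Z, (mon l (inord 3))%:Z).

Lemma exponent_surj x : simplex d%:Z x -> exists l, exponent l = x.
Proof.
move: x => [[a b] c] xd.
pose m := [multinom nth 0%N [:: (d - absz a - absz b - absz c)%N; absz a; absz b; absz c] i | i < 4].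
have [l lE] : exists l, @mon 3 d l = m.
  apply: mon_surj; rewrite mdegE !big_ord_recl big_ord0 !mnmE /=.
  by move: xd; rewrite /simplex /=; lia.
exists l; rewrite /exponent lE !mnmE !inordK //=.
by move: xd; rewrite /simplex /= => xd; congr (_, _, _); lia.
Qed.

Definition homog_pt (v : K * K * K) : 'rV[K]_4 := \row_j nth 0 [:: 1; v.1.1; v.1.2; v.2] j.

Lemma chi_veronese v l : chi v (exponent l) = veronese_vec d (homog_pt v) 0 l.
Proof.
have i1 : inord 1 = lift ord0 ord0 :> 'I_4 by apply/val_inj; rewrite /= inordK.
have i2 : inord 2 = lift ord0 (lift ord0 ord0) :> 'I_4 by apply/val_inj; rewrite /= inordK.
have i3 : inord 3 = lift ord0 (lift ord0 (lift ord0 ord0)) :> 'I_4.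
  by apply/val_inj; rewrite /= inordK.
rewrite veronese_vecE !big_ord_recl big_ord0 !mxE /= expr1n mul1r mulr1 mulrA.
by rewrite /chi /exponent i1 i2 i3.
Qed.

Lemma condmx_sub_jac (vs : seq (K * K * K)) : size vs = k.+1 -> all (@torus K) vs ->
  (conds exponent vs <= jac (secant_map K 3 d k)
     (mxvec (\matrix_(i < k.+1) homog_pt (nth (1, 1, 1) vs i))))%MS.
Proof.
move=> sz tor; set x := mxvec _; set J := jac _ _.
rewrite /conds big_seq; apply: (big_ind (fun A : 'M[K]_N.+1 => (A <= J)%MS)) => [|A B|v vvs];
  rewrite ?sub0mx //.
  by rewrite addsmx_sub => -> ->.
rewrite genmxE; have iv : (index v vs < k.+1)%N by rewrite -sz index_mem.
pose i := Ordinal iv; pose h := homog_pt v.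
have rowx : row i (vec_mx x) = h by rewrite mxvecK rowK /= nth_index.
have JE j l : h 0 j * J (mxvec_index i j) l = (mon l j)%:R * chi v (exponent l).
  rewrite chi_veronese -/h -rowx -jac_secant; congr (_ * _).
  by rewrite [LHS]mxE [LHS]mxE.
have rowJ a l : row a J 0 l = J a l by rewrite [LHS]mxE.
(* By Euler's identity, divided by [d], the row of values is a combination of Jacobian rows; every
   other row is a multiple of one of them. *)
apply/row_subP => j; have [j0|j0] := eqVneq j 0.
  rewrite (_ : row j _ = \sum_j' (h 0 j' / d%:R) *: row (mxvec_index i j') J).
    by apply: summx_sub => j' _; rewrite scalemx_sub // row_sub.
  apply/rowP => l; rewrite summxE.
  transitivity (\sum_j' (h 0 j' * J (mxvec_index i j') l) / d%:R); last first.
    by apply: eq_bigr => j' _; rewrite [RHS]mxE rowJ mulrAC.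
  under eq_bigr => j' _ do rewrite JE.
  rewrite -!mulr_suml -natr_sum -mdegE mdeg_mon mulrAC divff ?mul1r.
    by rewrite !mxE j0 /coef /= mul1r.
  by rewrite pnatr_eq0 -lt0n; apply: leq_trans d_ge5.
rewrite (_ : row j _ = h 0 j *: row (mxvec_index i j) J) ?scalemx_sub ?row_sub //.
apply/rowP => l; rewrite [RHS]mxE rowJ JE !mxE; congr (_ * _).
rewrite /coef /exponent; case: j j0 => [[|[|[|[|//]]]] jlt] j0.
- by case/eqP: j0; apply/val_inj.
- rewrite /= -[LHS]/((mon l _)%:R); congr ((mon l _)%:R); apply/val_inj; rewrite /= inordK //.
- rewrite /= -[LHS]/((mon l _)%:R); congr ((mon l _)%:R); apply/val_inj; rewrite /= inordK //.
- rewrite /= -[LHS]/((mon l _)%:R); congr ((mon l _)%:R); apply/val_inj; rewrite /= inordK //.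
Qed.

Lemma rank_jac_secant : exists p, (minn (4 * k.+1) N.+1 <= \rank (jac (secant_map K 3 d k) p))%N.
Proof.
have fs : full (simplex d%:Z) N.+1.
  by rewrite prednK ?bin_gt0 ?leq_addl //; apply: full_simplex.
have [vs [sz tor rk]] := @rank_conds_full K _ exponent _ k fs exponent_surj.
by eexists; apply: leq_trans rk (mxrankS (condmx_sub_jac sz tor)).
Qed.

(** * Dimension of the secant varieties *)

Lemma krull_dimE N (X : set (pspace K N)) r : is_krull_dim X r -> krull_dim X = r.
Proof.
move=> Xr; apply: (xget_unique 0%N Xr) => s [[Z sZ] sP].
have [[Z' rZ'] rP] := Xr; apply/eqP; rewrite eqn_leq.
by rewrite (rP _ _ sZ) (sP _ _ rZ').
Qed.

Lemma krull_dim_le N (X : set (pspace K N)) r :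
  (forall s Z, closed_chain X s Z -> (s <= r)%N) -> (krull_dim X <= r)%N.
Proof.
by move=> Xr; rewrite /krull_dim; case: xgetP => // s _ [[Z sZ] _]; apply: Xr sZ.
Qed.

Lemma krull_dim_Sec_Veronese :
  krull_dim (Sec k (Veronese K 3 d)) = minn (4 * k.+1 - 1) N.
Proof.
have d0 : (0 < d)%N by lia.
apply: krull_dimE; split.
  have [p rk] := rank_jac_secant.
  by apply: (chain_Sec_lower d0 (p := p)); lia.
move=> s Z sZ; rewrite leq_min (chain_pspace_upper sZ) andbT.
(* For [k > N] the minimum is [N], the bound by the ambient space. *)
have [kN|kN] := leqP k N; first by have := chain_Sec_upper d0 kN sZ; lia.
by have := chain_pspace_upper sZ; lia.
Qed.

End VeroneseRank.

Close Scope classical_set_scope.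
Close Scope ring_scope.

Theorem mainTheorem1 (R : realType) (d k : nat) (hd : (5 <= d)%N) :
  ~ k_defective k (Veronese R[i] 3 d) /\
  krull_dim (Sec k (Veronese R[i] 3 d)) =
    minn (4 * (k + 1) - 1) ('C(d + 3, 3) - 1).
Proof.
have dimE : krull_dim (Sec k (Veronese R[i] 3 d)) = minn (4 * (k + 1) - 1) ('C(d + 3, 3) - 1).
  by rewrite addn1 [X in minn _ X]subn1; exact: (krull_dim_Sec_Veronese (R[i] : numClosedFieldType) k hd).
split=> //; rewrite /k_defective dimE /expected_dim; apply/negP; rewrite -leqNgt.
(* The expected dimension grows with that of the variety, so an upper bound suffices; it comes from
   [Sec 0], which contains the Veronese threefold. *)
have dimV : (krull_dim (Veronese R[i] 3 d) <= 3)%N.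
  apply: krull_dim_le => s Z [Z1 Z2].
  have sZ : closed_chain (Sec 0 (Veronese R[i] 3 d)) s Z.
    split=> // i /Z1[cl irr ZV]; split=> //; apply: subset_trans ZV _.
    apply: subset_trans (@sub_gen_smallest _ _ _) => q Vq.
    exists (fun=> q); split=> //; rewrite big_ord1 //; exact/eqP/(valP q).
  have d_gt0 : (0 < d)%N by lia.
  by have := @chain_Sec_upper (R[i] : numClosedFieldType) 3 d 0 d_gt0 s Z (leq0n _) sZ; lia.
have : ((krull_dim (Veronese R[i] 3 d) + 1) * (k + 1) <= 4 * (k + 1))%N.
  by apply: leq_mul; rewrite // addn1 ltnS.
by rewrite subn1; move: (_ * _)%N; lia.
Qed.
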